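(* For $t>1$ let $\lambda_t\in V_{3,8}$ be defined by $$J_{\lambda_t}(xZ_1+yZ_2+zZ_3)=\begin{bmatrix} 0&0&-x&-y&0&0&0&-z \\ 0&0&ty&-x&0&0&-z&0 \\ x&-ty&0&-y&0&-z&-y&-y \\ y&x&y&0&-z&0&-y&-y \\ 0&0&0&z&0&0&-x&-y \\ 0&0&z&0&0&0&y&-x \\ 0&z&y&y&x&-y&0&-y \\ z&0&y&y&y&x&y&0 \end{bmatrix}.$$ Then $\lambda_t$, $t>1$, is a $1$-parameter family of pairwise non-isomorphic nonsingular algebras with Pfaffian forms given by $$f_{\lambda_t}(x,y,z)=(x^2+y^2+z^2)(x^2+t\,y^2+z^2),$$ which do not admit a nilsoliton inner product.
   Context: Let $\mathfrak{n}=\mathfrak{n}_1\oplus\mathfrak{n}_2$ be a real inner product space with $\mathfrak{n}_1\perp\mathfrak{n}_2$ and orthonormal bases $\{X_1,\dots,X_8\}$ of $\mathfrak{n}_1$, $\{Z_1,Z_2,Z_3\}$ of $\mathfrak{n}_2$. $V_{3,8}=\Lambda^2\mathfrak{n}_1^*\otimes\mathfrak{n}_2$ is the space of bilinear skew-symmetric maps $\mu:\mathfrak{n}_1\times\mathfrak{n}_1\to\mathfrak{n}_2$, each regarded as a $2$-step nilpotent Lie bracket on $\mathfrak{n}$ (with $\mathfrak{n}_2$ central) and determined by the linear map $J_\mu:\mathfrak{n}_2\to\mathfrak{so}(\mathfrak{n}_1)$, $\langle J_\mu(Z)X,Y\rangle=\langle\mu(X,Y),Z\rangle$ (matrices are with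 respect to $\{X_i\}$). $\mu$ is nonsingular if $J_\mu(Z)$ is invertible for all $Z\neq0$. Isomorphic means isomorphic as Lie algebras. Pfaffian form: $f_\mu(x,y,z)=\operatorname{Pf}(J_\mu(xZ_1+yZ_2+zZ_3))$, where $\operatorname{Pf}:\mathfrak{so}(\mathfrak{n}_1)\to\mathbb{R}$ is the polynomial function with $\operatorname{Pf}(B)^2=\det B$ and $\operatorname{Pf}(J_0)=1$ for a fixed $J_0\in\mathfrak{so}(\mathfrak{n}_1)$ having only $\pm\mathrm{i}$ as eigenvalues; the choice of $J_0$ only affects the overall sign, which is here taken (uniformly in $t$) so that the form is positive. A nilsoliton inner product for $(\mathfrak{n},\mu)$ is an inner product on $\mathfrak{n}$ such that the corresponding left-invariant Riemannian metric $g$ on the simply connected nilpotent Lie group with Lie algebra $(\mathfrak{n},\mu)$ is a Ricci soliton, i.e. the Ricci flow solution starting at $g$ evolves only by time-dependent scaling and pull-back by diffeomorphisms; in this setting this is known to be equivalent to: the Ricci operator of $g$ equals $cI+D$ for some $c\in\mathbb{R}$ and some derivation $D$ of $(\mathfrak{n},\mu)$. *)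

(* Defs.v *)
From HB Require Import structures.
From mathcomp Require Import all_boot all_order all_algebra.
From mathcomp Require Import sesquilinear complex reals.
From mathcomp Require mpoly.
From mathcomp Require Import ring.

Set Implicit Arguments.
Unset Strict Implicit.
Unset Printing Implicit Defensive.

Import Order.TTheory GRing.Theory Num.Theory.
Local Open Scope ring_scope.

(* n_1 = R^p and n_2 = R^q are column spaces, the given orthonormal bases being
   the standard ones, and n = n_1 (+) n_2 = R^(p + q).  Endomorphisms are
   matrices acting on columns from the left. *)
Definition evec {R : realType} {n : nat} (i : 'I_n) : 'cV[R]_n := delta_mx i 0.

Definition dotp {R : realType} {n : nat} (u v : 'cV[R]_n) : R :=
  (u^T *m v) 0 0.

Lemma col_sum_evec (R : realType) (n : nat) (u : 'cV[R]_n) : u = \sum_i u i 0 *: evec i.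
Proof. by rewrite [LHS]matrix_sum_delta; apply: eq_bigr => i _; rewrite big_ord1. Qed.

Lemma form_colE (R : realType) (n : nat)
    (b : 'cV[R]_n -> 'cV[R]_n -> R) :
    (forall Z, scalar (b ^~ Z)) -> (forall Z, scalar (b Z)) ->
  forall X Y, b X Y = (X^T *m (\matrix_(i, j) b (evec i) (evec j)) *m Y) 0 0.
Proof.
move=> bl br' X Y.
have sumE (f : 'cV[R]_n -> R) : scalar f ->
    forall u, f u = \sum_i u i 0 * f (evec i).
  move=> lf u; pose F := GRing.isLinear.Build _ _ _ _ f lf.
  pose h : {scalar 'cV[R]_n} := HB.pack f F.
  rewrite {1}(col_sum_evec u) -[f]/(h : _ -> _) linear_sum.
  by apply: eq_bigr => i _; rewrite linearZ.
rewrite (sumE (b ^~ Y)) // -mulmxA mxE; apply: eq_bigr => i _.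
rewrite [in RHS]mxE (sumE (b (evec i))) // mxE; congr (_ * _).
by apply: eq_bigr => j _; rewrite mxE mulrC.
Qed.

Lemma dotpC (R : realType) (n : nat) (u v : 'cV[R]_n) : dotp u v = dotp v u.
Proof. by rewrite /dotp !mxE; apply: eq_bigr => i _; rewrite !mxE mulrC. Qed.

Lemma dotpPl (R : realType) (n : nat) a (u v w : 'cV[R]_n) :
  dotp (a *: u + v) w = a * dotp u w + dotp v w.
Proof. by rewrite /dotp linearP /= mulmxDl -scalemxAl !mxE. Qed.

Lemma dotpPr (R : realType) (n : nat) a (u v w : 'cV[R]_n) :
  dotp w (a *: u + v) = a * dotp w u + dotp w v.
Proof. by rewrite !(dotpC w) dotpPl. Qed.

Lemma dotp_mul_evec (R : realType) (n : nat) (A : 'M[R]_n) i j :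
  dotp (A *m evec j) (evec i) = A i j.
Proof. by rewrite dotpC /dotp trmx_delta -rowE -colE !mxE. Qed.

Record skewBilin (R : realType) (q p : nat) := SkewBilin {
  sbmap :> {bilinear 'cV[R]_p -> 'cV[R]_p -> 'cV[R]_q};
  sbmap_skew : forall X Y, sbmap Y X = - sbmap X Y
}.

(* The matrix of the operator J with <J X, Y> = <mu(X, Y), Z>; the entry (i, j)
   is <J e_j, e_i>. *)
Definition Jop {R : realType} {q p : nat} (mu : skewBilin R q p)
    (Z : 'cV[R]_q) : 'M[R]_p :=
  \matrix_(i, j) dotp (mu (evec j) (evec i)) Z.

Lemma Jop_spec (R : realType) (q p : nat) (mu : skewBilin R q p) X Y Z :
  dotp (Jop mu Z *m X) Y = dotp (mu X Y) Z.
Proof.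
rewrite (form_colE (b := fun U V => dotp (mu U V) Z)).
- rewrite {1}/dotp trmx_mul; congr ((_ *m _ *m _) _ _).
  by apply/matrixP => i j; rewrite ![in LHS]mxE [in RHS]mxE.
- by move=> V a U U'; rewrite linearPl dotpPl.
- by move=> U a V V'; rewrite linearPr dotpPl.
Qed.

Definition nonsingular {R : realType} {q p : nat} (mu : skewBilin R q p) : Prop :=
  forall Z : 'cV[R]_q, Z != 0 -> Jop mu Z \in unitmx.

Definition lie {R : realType} {q p : nat} (mu : skewBilin R q p)
    (u v : 'cV[R]_(p + q)) : 'cV[R]_(p + q) :=
  col_mx 0 (mu (usubmx u) (usubmx v)).

Definition lie_isomorphic {R : realType} {q p : nat}
    (mu nu : skewBilin R q p) : Prop :=
  exists2 phi : {linear 'cV[R]_(p + q) -> 'cV[R]_(p + q)},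
    bijective phi & {morph phi : u v / lie mu u v >-> lie nu u v}.

Definition derivation {R : realType} {q p : nat} (mu : skewBilin R q p)
    (D : 'M[R]_(p + q)) : Prop :=
  forall u v, D *m lie mu u v = lie mu (D *m u) v + lie mu u (D *m v).

Section Curvature.

Variables (R : realType) (n : nat).
Variables (br : 'cV[R]_n -> 'cV[R]_n -> 'cV[R]_n).
Variable (g : {dot 'cV[R]_n for idfun}).

Definition gram : 'M[R]_n := \matrix_(i, j) g (evec i) (evec j).

(* The endomorphism A with g (A X) Y = b X Y, see [op_of_formE]. *)
Definition op_of_form (b : 'cV[R]_n -> 'cV[R]_n -> R) : 'M[R]_n :=
  invmx gram *m \matrix_(i, j) b (evec j) (evec i).

(* Levi-Civita connection of the left-invariant metric defined by g, on
   left-invariant fields, by Koszul's formula: nabla X is Y |-> nabla_X Y. *)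
Definition nabla (X : 'cV[R]_n) : 'M[R]_n :=
  op_of_form (fun Y Z => 2^-1 * (g (br X Y) Z - g (br Y Z) X + g (br Z X) Y)).

Definition curvature (X Y : 'cV[R]_n) : 'M[R]_n :=
  nabla X *m nabla Y - nabla Y *m nabla X - nabla (br X Y).

(* The trace of X |-> R(X, Y) Z. *)
Definition ricci_tensor (Y Z : 'cV[R]_n) : R :=
  \sum_i (curvature (evec i) Y *m Z) i 0.

Definition ricci_operator : 'M[R]_n := op_of_form ricci_tensor.

Lemma gformE u v : g u v = (u^T *m gram *m v) 0 0.
Proof.
by apply: form_colE => Z a x y; rewrite ?linearPl ?linearPr.
Qed.

Lemma gramT : gram^T = gram.
Proof. by apply/matrixP => i j; rewrite !mxE hermC expr0 mul1r. Qed.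

Lemma gram_unit : gram \in unitmx.
Proof.
rewrite -row_free_unit; apply: inj_row_free => v v0; apply/eqP.
have : g v^T v^T = 0 by rewrite gformE trmxK v0 mul0mx mxE.
apply: contra_eqT => vN0; rewrite gt_eqF // neq0_dnorm_gt0 //.
by rewrite -trmx0 (inj_eq trmx_inj).
Qed.

Lemma op_of_formE (b : 'cV[R]_n -> 'cV[R]_n -> R) X Y :
    (forall Z, scalar (b ^~ Z)) -> (forall Z, scalar (b Z)) ->
  g (op_of_form b *m X) Y = b X Y.
Proof.
move=> bl br'; rewrite gformE /op_of_form !trmx_mul trmx_inv gramT -!mulmxA.
rewrite (mulmxA (invmx gram)) mulVmx ?gram_unit // mul1mx mulmxA.
rewrite (form_colE bl br'); congr ((_ *m _ *m _) _ _).
by apply/matrixP => i j; rewrite !mxE.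
Qed.

End Curvature.

(* The algebraic form of the Ricci soliton condition for left-invariant metrics
   on simply connected nilpotent Lie groups: Ric = c Id + D. *)
Definition nilsoliton {R : realType} {q p : nat} (mu : skewBilin R q p)
    (g : {dot 'cV[R]_(p + q) for idfun}) : Prop :=
  exists (c : R) (D : 'M[R]_(p + q)),
    derivation mu D /\ ricci_operator (lie mu) g = c%:M + D.

Definition skewmat {R : realType} {p : nat} (B : 'M[R]_p) : Prop := B^T = - B.

Definition polynomial_on_so {R : realType} {p : nat} (F : 'M[R]_p -> R) : Prop :=
  exists P : mpoly.mpoly (p * p) R,
    forall B, skewmat B -> F B = mpoly.meval (mxvec B 0) P.

Definition only_eigenvalues_pm_i {R : realType} {p : nat} (B : 'M[R]_p) : Prop :=
  forall a : R[i], eigenvalue (map_mx (real_complex R) B) a ->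
    a = Complex 0 1 \/ a = - Complex 0 1.

(* Pf is a total function, but only its restriction to so(p) is constrained;
   that restriction is determined by J0. *)
Definition is_pfaffian {R : realType} {p : nat} (J0 : 'M[R]_p)
    (Pf : 'M[R]_p -> R) : Prop :=
  [/\ skewmat J0, only_eigenvalues_pm_i J0, polynomial_on_so Pf,
      (forall B, skewmat B -> Pf B ^+ 2 = \det B) & Pf J0 = 1].

Definition vec3 {R : realType} (x y z : R) : 'cV[R]_3 :=
  \col_(k < 3) nth 0 [:: x; y; z] k.

Definition pfaffian_form {R : realType} {p : nat} (Pf : 'M[R]_p -> R)
    (mu : skewBilin R 3 p) (x y z : R) : R :=
  Pf (Jop mu (vec3 x y z)).

Definition Jlambda {R : realType} (t x y z : R) : 'M[R]_8 :=
  \matrix_(i, j) nth 0 (nth [::]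
  [:: [:: 0;  0;     - x;   - y; 0;   0;   0;   - z];
      [:: 0;  0;     t * y; - x; 0;   0;   - z; 0  ];
      [:: x; -(t*y); 0;     - y; 0;   - z; - y; - y];
      [:: y;  x;     y;     0;   - z; 0;   - y; - y];
      [:: 0;  0;     0;     z;   0;   0;   - x; - y];
      [:: 0;  0;     z;     0;   0;   0;   y;   - x];
      [:: 0;  z;     y;     y;   x;   - y; 0;   - y];
      [:: z;  0;     y;     y;   y;   x;   y;   0  ]] i) j.

Definition lambda_map {R : realType} (t : R) (X Y : 'cV[R]_8) : 'cV[R]_3 :=
  vec3 (dotp (Jlambda t 1 0 0 *m X) Y) (dotp (Jlambda t 0 1 0 *m X) Y)
       (dotp (Jlambda t 0 0 1 *m X) Y).

Lemma Jlambda_skew (R : realType) (t x y z : R) : skewmat (Jlambda t x y z).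
Proof.
apply/matrixP => i j; rewrite !mxE.
by case: i => [[|[|[|[|[|[|[|[|i]]]]]]]] Hi] //=;
   case: j => [[|[|[|[|[|[|[|[|j]]]]]]]] Hj] //=; rewrite ?oppr0 ?opprK.
Qed.

Lemma lambda_map_bilinear (R : realType) (t : R) :
  bilinear_for *:%R *:%R (@lambda_map R t).
Proof.
split=> [Y a X X'|X a Y Y']; apply/matrixP => i j; rewrite !mxE.
  by case: i => [[|[|[|//]]] ?] /=; rewrite mulmxDr -scalemxAr dotpPl.
by case: i => [[|[|[|//]]] ?] /=; rewrite dotpPr.
Qed.

HB.instance Definition _ (R : realType) (t : R) :=
  bilinear_isBilinear.Build R _ _ _ _ _ (@lambda_map R t)
    (lambda_map_bilinear t).

Lemma lambda_map_skew (R : realType) (t : R) X Y :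
  lambda_map t Y X = - lambda_map t X Y.
Proof.
have dE x y z : dotp (Jlambda t x y z *m Y) X = - dotp (Jlambda t x y z *m X) Y.
  rewrite dotpC /dotp trmx_mul (Jlambda_skew t x y z) mulmxN mulNmx.
  by rewrite [in RHS]mxE opprK mulmxA.
by apply/matrixP => i j; rewrite !mxE !dE; case: i => [[|[|[|//]]] ?].
Qed.

Definition lambda {R : realType} (t : R) : skewBilin R 3 8 :=
  SkewBilin (lambda_map_skew t).

Lemma Jop_lambda (R : realType) (t x y z : R) :
  Jop (lambda t) (vec3 x y z) = Jlambda t x y z.
Proof.
apply/matrixP => i j; rewrite mxE /= /lambda_map !dotp_mul_evec /dotp.
rewrite mxE !big_ord_recl big_ord0 !mxE /=.
by case: i => [[|[|[|[|[|[|[|[|i]]]]]]]] Hi] //=;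
   case: j => [[|[|[|[|[|[|[|[|j]]]]]]]] Hj] //=; ring.
Qed.

(* Main.v *)
(* In the basis reordered as (X_3, X_4, X_7, X_8; X_1, X_2, X_5, X_6), J(Z) is a block
   matrix [[N, - M^T], [M, 0]], so det J = (det M)^2, and det M is the quartic
   f_t = (x^2 + y^2 + z^2) (x^2 + t y^2 + z^2).  An isomorphism makes f_s and f_t
   proportional up to a linear change of variables; comparing the quadratic factors
   yields s = t.

   Let g be a nilsoliton metric with Ric = c + D.  As tr(J_k^-1 J_l) = 8 delta_kl, the
   blocks A and B of any derivation D satisfy 4 tr B = 3 tr A, so subtracting from D a
   multiple of the derivation (1, 2) gives a derivation D' whose two blocks are
   traceless.  Ric is trace-orthogonal to derivations, so tr(D'^2) = 0; as D' is
   g-symmetric, D' = 0.  Hence Ric is a multiple of the identity on the orthogonal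
   complement of the center, which is identified with n_1.  There
   W = <X_1, X_2, X_5, X_6> is isotropic of half the dimension, and comparing the
   traces of Ric on W and on its orthogonal U shows that U is isotropic as well.  But
   for t > 1 the subspace W has no isotropic complement. *)

Require Import Defs.
From HB Require Import structures.
From mathcomp Require Import all_boot all_order all_algebra.
From mathcomp Require Import sesquilinear reals.
From mathcomp Require mpoly.
From mathcomp Require Import ring lra.

Set Implicit Arguments.
Unset Strict Implicit.
Unset Printing Implicit Defensive.

Import Order.TTheory GRing.Theory Num.Theory.
Local Open Scope ring_scope.

(** * Block form of [Jlambda] and its determinant *)

(* The indices of a complement (first four) of the isotropic subspace spanned
   by [X_1, X_2, X_5, X_6] (last four). *)
Definition isotropic_order (i : 'I_8) : 'I_8 :=
  match val i with
  | 0 => @Ordinal 8 2 isT | 1 => @Ordinal 8 3 isT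
  | 2 => @Ordinal 8 6 isT | 3 => @Ordinal 8 7 isT
  | 4 => @Ordinal 8 0 isT | 5 => @Ordinal 8 1 isT
  | 6 => @Ordinal 8 4 isT | _ => @Ordinal 8 5 isT
  end.

Lemma isotropic_order_inj : injective isotropic_order.
Proof.
move=> i j /(congr1 val); case: i => [[|[|[|[|[|[|[|[|i]]]]]]]] Hi] //=;
   case: j => [[|[|[|[|[|[|[|[|j]]]]]]]] Hj] //= _; exact: val_inj.
Qed.

Definition offdiag_block {R : realType} (t x y z : R) : 'M[R]_4 :=
  \matrix_(i, j) nth 0 (nth [::]
  [:: [:: - x; - y; 0; - z];
      [:: t * y; - x; - z; 0];
      [:: 0; z; - x; - y];
      [:: z; 0; y; - x]] i) j.

Definition diag_block {R : realType} (y : R) : 'M[R]_4 :=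
  \matrix_(i, j) nth 0 (nth [::]
  [:: [:: 0; - y; - y; - y];
      [:: y; 0; - y; - y];
      [:: y; y; 0; - y];
      [:: y; y; y; 0]] i) j.

Definition order_mx {R : realType} : 'M[R]_(8, 4 + 4) := colsub isotropic_order 1%:M.

Lemma order_mx_conj (R : realType) (A : 'M[R]_8) :
  order_mx^T *m A *m order_mx = mxsub isotropic_order isotropic_order A.
Proof.
rewrite /order_mx trmx_mxsub trmx1 mul_rowsub_mx mul1mx mulmx_colsub mulmx1.
by apply/matrixP => i j; rewrite !mxE.
Qed.

Lemma order_mx_orth (R : realType) :
  order_mx^T *m order_mx = 1%:M :> 'M[R]_(4 + 4).
Proof.
rewrite -[X in X *m _]mulmx1 order_mx_conj; apply/matrixP => i j.
by rewrite !mxE (inj_eq isotropic_order_inj).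
Qed.

Lemma Jlambda_block (R : realType) (t x y z : R) :
  order_mx^T *m Jlambda t x y z *m order_mx =
  block_mx (diag_block y) (- (offdiag_block t x y z)^T)
           (offdiag_block t x y z) 0.
Proof.
rewrite order_mx_conj -[LHS](@submxK _ 4 4 4 4).
congr block_mx; apply/matrixP => i j; rewrite !mxE;
  case: i => [[|[|[|[|i]]]] Hi] //=; case: j => [[|[|[|[|j]]]] Hj] //=;
  by rewrite ?oppr0 ?opprK.
Qed.

Definition quartic {R : realType} (t x y z : R) : R :=
  (x ^+ 2 + y ^+ 2 + z ^+ 2) * (x ^+ 2 + t * y ^+ 2 + z ^+ 2).

Lemma det_offdiag_block (R : realType) (t x y z : R) :
  \det (offdiag_block t x y z) = quartic t x y z.
Proof.
do 3!rewrite /cofactor !(expand_det_row _ ord0) !big_ord_recl !big_ord0.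
rewrite /cofactor !det_mx11 !mxE /= /quartic.
by ring.
Qed.

(** Left multiplication by the block rotation with rows (0, -1) and (1, 0) gives a block lower
    triangular matrix with diagonal [- M], [- K], and the two signs cancel. The rotation has
    determinant 1, being a product of unipotent triangular matrices. *)
Lemma det_swap_block (R : comNzRingType) n (N K M : 'M[R]_n) :
  \det (block_mx N (- K) M 0) = \det M * \det K.
Proof.
pose U : 'M[R]_(n + n) := block_mx 1%:M (- 1%:M) 0 1%:M.
pose L : 'M[R]_(n + n) := block_mx 1%:M 0 1%:M 1%:M.
have dS : \det (U *m L *m U) = 1.
  by rewrite !det_mulmx det_lblock det_ublock !det1 !mulr1.
have SE : U *m L *m U = block_mx 0 (- 1%:M) 1%:M 0.
  rewrite /U /L !mulmx_block !(mulmx1, mul1mx, mulmx0, mul0mx, mulmxN, mulNmx).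
  by rewrite !(addr0, add0r, oppr0) subrr addNr oppr0 add0r.
rewrite -[LHS]mul1r -dS -det_mulmx SE mulmx_block.
rewrite !(mul0mx, mul1mx, mulNmx, mulmx0, addr0, add0r, oppr0).
rewrite det_lblock -scaleN1r detZ -[- K]scaleN1r detZ mulrACA -expr2 -exprM.
by rewrite mulnC exprM sqrrN !expr1n mul1r.
Qed.

Lemma det_Jlambda (R : realType) (t x y z : R) :
  \det (Jlambda t x y z) = quartic t x y z ^+ 2.
Proof.
have dQ : \det (@order_mx R : 'M_8) * \det (@order_mx R : 'M_8) = 1.
  by rewrite -{1}det_tr -det_mulmx order_mx_orth det1.
rewrite -[LHS]mulr1 -dQ mulrA -[X in _ * X * _]det_tr.
rewrite [_ * \det _^T]mulrC -!det_mulmx Jlambda_block.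
by rewrite (@det_swap_block _ 4) det_tr det_offdiag_block.
Qed.

Lemma quartic_gt0 (R : realType) (t x y z : R) :
  1 < t -> [|| x != 0, y != 0 | z != 0] -> 0 < quartic t x y z.
Proof.
move=> t1 nz.
have [[x2 y2] z2] := (sqr_ge0 x, sqr_ge0 y, sqr_ge0 z).
have sgt0 : 0 < x ^+ 2 + y ^+ 2 + z ^+ 2.
  by case/or3P: nz; rewrite -sqrf_eq0 neq_lt => /orP[]; lra.
have ty2 : 0 <= (t - 1) * y ^+ 2 by rewrite mulr_ge0 // subr_ge0 ltW.
by rewrite /quartic mulr_gt0 //; lra.
Qed.

Lemma vec3E (R : realType) (Z : 'cV[R]_3) : Z = vec3 (Z 0 0) (Z 1 0) (Z 2 0).
Proof.
apply/matrixP => i j; rewrite ord1 !mxE.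
by case: i => [[|[|[|//]]] ?] /=; congr (Z _ _); apply: val_inj.
Qed.

Lemma vec3_eq0 (R : realType) (x y z : R) :
  (vec3 x y z == 0) = [&& x == 0, y == 0 & z == 0].
Proof.
apply/eqP/and3P => [/matrixP Z0|[/eqP-> /eqP-> /eqP->]].
  by move: (Z0 0 0) (Z0 1 0) (Z0 2 0); rewrite !mxE /= => -> -> ->.
by apply/matrixP => i j; rewrite !mxE; case: i => [[|[|[|//]]] ?].
Qed.

Lemma lambda_nonsingular (R : realType) (t : R) : 1 < t -> nonsingular (lambda t).
Proof.
move=> t1 Z; rewrite (vec3E Z) vec3_eq0 !negb_and => Z0.
rewrite Jop_lambda unitmxE det_Jlambda unitfE sqrf_eq0 gt_eqF //.
exact: quartic_gt0.
Qed.

(** * The Pfaffian form *)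

Lemma poly_eq0_horner (R : realType) (p : {poly R}) : (forall s, p.[s] = 0) -> p = 0.
Proof.
move=> p0; apply/eqP/contraT => pN0.
have := @max_poly_roots _ p [seq i%:R | i <- iota 0 (size p)] pN0.
rewrite size_map size_iota ltnn; apply.
  by apply/allP => s _; apply/rootP.
by rewrite map_inj_uniq ?iota_uniq // => i j /eqP; rewrite eqr_nat => /eqP.
Qed.

(** Restricted to a curve, the polynomial defining [Pf] has one variable, and equal squares give
    equality up to one global sign. *)
Lemma meval_poly_curve (R : realType) (n : nat) (P : mpoly.mpoly n R)
    (c : 'I_n -> {poly R}) :
  exists p : {poly R}, forall s, p.[s] = mpoly.meval (fun i => (c i).[s]) P.
Proof.
exists (\sum_(m <- mpoly.msupp P)
          mpoly.mcoeff m P *: \prod_i c i ^+ mpoly.fun_of_multinom m i) => s.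
rewrite horner_sum mpoly.mevalE; apply: eq_bigr => m _.
rewrite hornerZ horner_prod; congr (_ * _); apply: eq_bigr => i _.
by rewrite horner_exp.
Qed.

(** The parameter [t] moves along the segment too, so the entries that contain [t * y] are quadratic
    in [s]; the difference of the last two matrices isolates their leading coefficient. *)
Lemma Jlambda_segment (R : realType) (t x y z s : R) :
  Jlambda (2 + (t - 2) * s) (1 + (x - 1) * s) (y * s) (z * s) =
  Jlambda 2 1 0 0 + s *: Jlambda 2 (x - 1) y z
  + s ^+ 2 *: Jlambda (t - 2) 0 y 0 - s ^+ 2 *: Jlambda 0 0 y 0.
Proof.
apply/matrixP => i j; rewrite !mxE.
case: i => [[|[|[|[|[|[|[|[|i]]]]]]]] Hi] //=;
   case: j => [[|[|[|[|[|[|[|[|j]]]]]]]] Hj] //=; ring.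
Qed.

(* On a segment from [(t, x, y, z) = (2, 1, 0, 0)], both sides are polynomials
   with the same square, hence equal up to a sign fixed at the starting point. *)
Lemma pfaffian_lambda (R : realType) (J0 : 'M[R]_8) (Pf : 'M[R]_8 -> R) :
    is_pfaffian J0 Pf ->
  exists2 e : R, e = 1 \/ e = -1 &
    forall t x y z : R, e * pfaffian_form Pf (lambda t) x y z = quartic t x y z.
Proof.
case=> _ _ [P PfE] Pf2 _.
have PfJ2 t x y z : Pf (Jlambda t x y z) ^+ 2 = quartic t x y z ^+ 2.
  by rewrite Pf2 ?det_Jlambda //; exact: Jlambda_skew.
(* The sign is read off at a base point common to all [t], hence it is uniform in [t]. *)
set e := Pf (Jlambda 2 1 0 0); have q1 : quartic 2 1 0 0 = 1 :> R.
  by rewrite /quartic; ring.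
have e1 : e = 1 \/ e = -1.
  have /eqP := PfJ2 2 1 0 0; rewrite q1 eqf_sqr.
  by case/orP => /eqP; [left|right].
exists e => // t x y z; rewrite /pfaffian_form Jop_lambda.
pose c k := (mxvec (Jlambda 2 1 0 0) 0 k)%:P
  + mxvec (Jlambda 2 (x - 1) y z) 0 k *: 'X
  + mxvec (Jlambda (t - 2) 0 y 0 - Jlambda 0 0 y 0) 0 k *: 'X^2.
have [p pE] := meval_poly_curve P c.
have pJ s : p.[s] = Pf (Jlambda (2 + (t - 2) * s) (1 + (x - 1) * s) (y * s) (z * s)).
  rewrite pE PfE; last exact: Jlambda_skew.
  apply: mpoly.meval_eq => k; rewrite Jlambda_segment /c.
  rewrite !(hornerD, hornerZ, hornerC, hornerX, hornerXn).
  move: (Jlambda 2 1 0 0) (Jlambda 2 _ y z) (Jlambda _ 0 y 0) (Jlambda 0 _ _ _).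
  by move=> A1 A2 A3 A4; case/mxvec_indexP: k => i j; rewrite !mxvecE !mxE; ring.
pose T := 2 + (t - 2) *: 'X : {poly R}; pose X := 1 + (x - 1) *: 'X : {poly R}.
pose Y := y *: 'X : {poly R}; pose Z := z *: 'X : {poly R}.
pose q := (X ^+ 2 + Y ^+ 2 + Z ^+ 2) * (X ^+ 2 + T * Y ^+ 2 + Z ^+ 2).
have qE s : q.[s] = quartic (2 + (t - 2) * s) (1 + (x - 1) * s) (y * s) (z * s).
  by rewrite /q /quartic /T /X /Y /Z !hornerE.
have /eqP : p ^+ 2 = q ^+ 2.
  apply/eqP; rewrite -subr_eq0; apply/eqP/poly_eq0_horner => s.
  by rewrite hornerD hornerN !horner_exp pJ qE PfJ2 subrr.
have p0 : p.[0] = e by rewrite pJ !mulr0 !addr0.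
have q0 : q.[0] = 1 by rewrite qE !mulr0 !addr0.
have p1 : p.[1] = Pf (Jlambda t x y z).
  by rewrite pJ; congr (Pf (Jlambda _ _ _ _)); ring.
have <- : q.[1] = quartic t x y z by rewrite qE; congr (quartic _ _ _ _); ring.
rewrite -p1 eqf_sqr => /orP[/eqP pq|/eqP pq].
  by rewrite -p0 pq q0 mul1r.
by rewrite -p0 pq !hornerN q0; ring.
Qed.

(** * Isomorphisms *)

Lemma quartic_form_coef0 (R : realType)
    (a400 a310 a301 a220 a211 a202 a130 a121 a112 a103 a040 a031 a022 a013 a004 : R) :
  (forall x y z : R,
     a400 * x ^+ 4 + a310 * x ^+ 3 * y + a301 * x ^+ 3 * z
     + a220 * x ^+ 2 * y ^+ 2 + a211 * x ^+ 2 * y * z + a202 * x ^+ 2 * z ^+ 2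
     + a130 * x * y ^+ 3 + a121 * x * y ^+ 2 * z + a112 * x * y * z ^+ 2
     + a103 * x * z ^+ 3 + a040 * y ^+ 4 + a031 * y ^+ 3 * z
     + a022 * y ^+ 2 * z ^+ 2 + a013 * y * z ^+ 3 + a004 * z ^+ 4 = 0) ->
  [/\ [/\ a400 = 0, a310 = 0, a301 = 0, a220 = 0 & a211 = 0],
      [/\ a202 = 0, a130 = 0, a121 = 0, a112 = 0 & a103 = 0]
    & [/\ a040 = 0, a031 = 0, a022 = 0, a013 = 0 & a004 = 0]].
Proof.
move=> H.
have h1 : a400 = 0 by move: (H 1 0 0); lra.
have h2 : a040 = 0 by move: (H 0 1 0); lra.
have h3 : a004 = 0 by move: (H 0 0 1); lra.
have h4 : a220 = 0 by move: (H 1 1 0) (H 1 (-1) 0); lra.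
have h5 : a202 = 0 by move: (H 1 0 1) (H 1 0 (-1)); lra.
have h6 : a022 = 0 by move: (H 0 1 1) (H 0 1 (-1)); lra.
have h7 : a310 = 0 by move: (H 1 1 0) (H 2 1 0); lra.
have h8 : a301 = 0 by move: (H 1 0 1) (H 2 0 1); lra.
have h9 : a031 = 0 by move: (H 0 1 1) (H 0 2 1); lra.
have h10 : a130 = 0 by move: (H 1 1 0); lra.
have h11 : a103 = 0 by move: (H 1 0 1); lra.
have h12 : a013 = 0 by move: (H 0 1 1); lra.
have h13 : a211 = 0 by move: (H 1 1 1) (H (-1) 1 1); lra.
have h14 : a121 = 0 by move: (H 1 1 1) (H 1 (-1) 1); lra.
have h15 : a112 = 0 by move: (H 1 1 1); lra.
by [].
Qed.

(** On the plane y = 0 the product is k (x^2 + z^2)^2, so both restrictions are multiples of x^2 +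
    z^2. The coefficients involving [y] are then determined by comparison, up to exchanging the two
    factors. *)
Lemma quartic_factor (R : realType) (t k a b c d e f a' b' c' d' e' f' : R) :
    0 < k -> 0 <= a -> 0 <= a' -> 0 <= c -> 0 <= c' ->
    (forall x y z : R,
      (a * x ^+ 2 + b * x * z + c * z ^+ 2 + d * y ^+ 2 + e * x * y + f * y * z)
      * (a' * x ^+ 2 + b' * x * z + c' * z ^+ 2 + d' * y ^+ 2 + e' * x * y
         + f' * y * z)
      = k * quartic t x y z) ->
  [/\ [/\ 0 < a, b = 0, c = a, e = 0 & f = 0],
      [/\ 0 < a', b' = 0, c' = a', e' = 0 & f' = 0],
      a * a' = k
    & (a * d' = k /\ a' * d = k * t) \/ (a * d' = k * t /\ a' * d = k)].
Proof.
move=> k0 a0 a'0 c0 c'0 H.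
have [] := @quartic_form_coef0 R (a * a' - k) (a * e' + e * a') (a * b' + b * a')
  (a * d' + e * e' + d * a' - k * (1 + t)) (a * f' + f * a' + b * e' + e * b')
  (a * c' + b * b' + c * a' - 2 * k) (d * e' + e * d')
  (d * b' + b * d' + e * f' + f * e') (c * e' + e * c' + b * f' + f * b')
  (b * c' + c * b') (d * d' - k * t) (d * f' + f * d')
  (d * c' + c * d' + f * f' - k * (1 + t)) (c * f' + f * c') (c * c' - k).
  by move=> x y z; move: (H x y z); rewrite /quartic => /eqP;
     rewrite -subr_eq0 => /eqP <-; ring.
case=> h400 h310 h301 h220 _ [h202 _ h121 _ h103] [h040 _ h022 h013 h004].
have ap : 0 < a.
  by rewrite lt_def a0 andbT; apply: contraTneq k0 => az; rewrite -leNgt; nra.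
have a'p : 0 < a'.
  by rewrite lt_def a'0 andbT; apply: contraTneq k0 => az; rewrite -leNgt; nra.
have an := lt0r_neq0 ap; have a'n := lt0r_neq0 a'p.
(* If [b = 0], the numbers [a * c'] and [a' * c] have sum 2k and product k^2, so they coincide. *)
have ac : a * c' = a' * c.
  have : b * (a * c' - a' * c) = 0.
    have -> : b * (a * c' - a' * c) = a * (b * c' + c * b') - c * (a * b' + b * a').
      by ring.
    by rewrite h103 h301; ring.
  move/eqP; rewrite mulf_eq0 => /orP[/eqP bz|/eqP]; last by lra.
  suff : (a * c' - a' * c) ^+ 2 = 0 by move/eqP; rewrite sqrf_eq0 => /eqP; lra.
  have s2 : a * c' + a' * c = 2 * k by move: h202; rewrite bz; lra.
  have -> : (a * c' - a' * c) ^+ 2 = (a * c' + a' * c) ^+ 2 - 4 * (a * a') * (c * c').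
    by ring.
  have -> : a * a' = k by lra.
  have -> : c * c' = k by lra.
  by rewrite s2; ring.
have ca : c = a.
  apply/eqP; rewrite -subr_eq0; apply/eqP.
  have : a' * ((c - a) * (c + a)) = 0.
    have -> : a' * ((c - a) * (c + a)) =
       c * (a' * c - a * c') + a * (c * c' - k) - a * (a * a' - k) by ring.
    by rewrite ac subrr h004 h400; ring.
  move/eqP; rewrite !mulf_eq0 (negPf a'n) /= => /orP[/eqP//|/eqP]; lra.
have ca' : c' = a' by apply: (mulfI an); rewrite ac ca mulrC.
have bz : b = 0.
  have : a' * b ^+ 2 = 0.
    have -> : a' * b ^+ 2 = b * (a * b' + b * a') - a * (b * b') by ring.
    have -> : b * b' = 0 by move: h202; rewrite ca ca'; lra.
    by rewrite h301; ring.
  by move/eqP; rewrite mulf_eq0 (negPf a'n) sqrf_eq0 => /eqP.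
have bz' : b' = 0 by apply: (mulfI an); move: h301; rewrite bz; lra.
(* Together with [e ^+ 2 = f ^+ 2] below, this forces [e] and [f] to vanish. *)
have ef : e * f = 0.
  apply: (mulfI a'n); have -> : a' * (e * f) = 2^-1 * (e * (c * f' + f * c')
     + f * (a * e' + e * a') - a * (e * f' + f * e')) by rewrite ca ca'; field.
  rewrite h013 h310; have -> : e * f' + f * e' = 0 by move: h121; rewrite bz bz'; lra.
  by ring.
have e2f2 : e ^+ 2 = f ^+ 2.
  apply: (mulfI a'n); apply/eqP; rewrite -subr_eq0; apply/eqP.
  have -> : a' * e ^+ 2 - a' * f ^+ 2 = e * (a * e' + e * a') - f * (c * f' + f * c')
     - a * (e * e' - f * f') by rewrite ca ca'; ring.
  rewrite h013 h310; have -> : e * e' - f * f' = 0.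
    by move: h220 h022; rewrite ca ca'; lra.
  by ring.
have ez : e = 0.
  apply/eqP; rewrite -sqrf_eq0 -sqrf_eq0 {1}e2f2; apply/eqP.
  have -> : (f ^+ 2) ^+ 2 = f ^+ 2 * e ^+ 2 by rewrite e2f2.
  by rewrite -exprMn mulrC ef expr0n.
have fz : f = 0 by apply/eqP; rewrite -sqrf_eq0 -e2f2 ez expr0n.
have ez' : e' = 0 by apply: (mulfI an); move: h310; rewrite ez; lra.
have fz' : f' = 0 by apply: (mulfI an); move: h013; rewrite fz ca; lra.
have kE : a * a' = k by lra.
split=> //.
(* [a * d'] and [a' * d] have sum k (1 + t) and product k^2 t, so they are k and k t in some
   order. *)
have : (a * d' - k) * (a * d' - k * t) = 0.
  have -> : (a * d' - k) * (a * d' - k * t) = (a * d') * (a * d' + e * e' + d * a'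
    - k * (1 + t)) - a * a' * (d * d' - k * t) + k * t * (k - a * a').
    by rewrite ez; ring.
  by rewrite h220 h040 kE; ring.
move/eqP; rewrite mulf_eq0 => /orP[]/eqP q; [left|right];
  move: h220; rewrite ez; split; lra.
Qed.

(** By [quartic_factor] the pullbacks of x^2 + y^2 + z^2 and x^2 + s y^2 + z^2 are diagonal, with
    equal coefficients at x^2 and z^2. Their difference is s - 1 times the square of the second row
    of [C], so that row involves only [y]. The first pullback is then a multiple of the standard
    form, and the ratio of the y^2 coefficients is both s and t. *)
Lemma quartic_rigid (R : realType) (s t k : R) (C : 'M[R]_3) :
    1 < s -> 1 < t -> 0 < k ->
    (forall x y z, let v := C *m vec3 x y z in
       quartic s (v 0 0) (v 1 0) (v 2 0) = k * quartic t x y z) ->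
  s = t.
Proof.
move=> s1 t1 k0 H.
have vE x y z i : (C *m vec3 x y z) i 0 = C i 0 * x + C i 1 * y + C i 2 * z.
  rewrite !mxE !big_ord_recl big_ord0 !mxE /= addr0 addrA.
  by congr (C i _ * _ + C i _ * _ + C i _ * _); apply: val_inj.
have {}H x y z : quartic s (C 0 0 * x + C 0 1 * y + C 0 2 * z)
    (C 1 0 * x + C 1 1 * y + C 1 2 * z) (C 2 0 * x + C 2 1 * y + C 2 2 * z)
    = k * quartic t x y z by rewrite -H /= !vE.
move: (C 0 0) (C 0 1) (C 0 2) (C 1 0) (C 1 1) (C 1 2) (C 2 0) (C 2 1) (C 2 2) H
  => {vE C} x0 x1 x2 y0 y1 y2 z0 z1 z2 H.
have s0 : 0 <= s by lra.
have [] := @quartic_factor R t k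
  (x0 ^+ 2 + y0 ^+ 2 + z0 ^+ 2) (2 * (x0 * x2 + y0 * y2 + z0 * z2))
  (x2 ^+ 2 + y2 ^+ 2 + z2 ^+ 2) (x1 ^+ 2 + y1 ^+ 2 + z1 ^+ 2)
  (2 * (x0 * x1 + y0 * y1 + z0 * z1)) (2 * (x1 * x2 + y1 * y2 + z1 * z2))
  (x0 ^+ 2 + s * y0 ^+ 2 + z0 ^+ 2) (2 * (x0 * x2 + s * y0 * y2 + z0 * z2))
  (x2 ^+ 2 + s * y2 ^+ 2 + z2 ^+ 2) (x1 ^+ 2 + s * y1 ^+ 2 + z1 ^+ 2)
  (2 * (x0 * x1 + s * y0 * y1 + z0 * z1)) (2 * (x1 * x2 + s * y1 * y2 + z1 * z2)) k0.
- by rewrite !addr_ge0 ?sqr_ge0.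
- by rewrite !addr_ge0 ?sqr_ge0 // mulr_ge0 ?sqr_ge0.
- by rewrite !addr_ge0 ?sqr_ge0.
- by rewrite !addr_ge0 ?sqr_ge0 // mulr_ge0 ?sqr_ge0.
- by move=> x y z; rewrite -H /quartic; ring.
set a := x0 ^+ 2 + _ + _; set a' := x0 ^+ 2 + _ + _; set d' := x1 ^+ 2 + _ + _.
set d := x1 ^+ 2 + _ + _ => -[a0 bz ca ez fz] [a'0 bz' ca' _ _] kE dd'.
have sy (u : R) : (s - 1) * u = 0 -> u = 0.
  by move/eqP; rewrite mulf_eq0 subr_eq0 (gt_eqF s1) => /eqP.
have y02 : y0 * y2 = 0 by apply: sy; move: bz bz'; lra.
have yy : y0 ^+ 2 = y2 ^+ 2.
  apply/eqP; rewrite -subr_eq0; apply/eqP/sy; move: ca ca'; rewrite /a /a'; lra.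
have y0z : y0 = 0.
  apply/eqP; rewrite -sqrf_eq0 -sqrf_eq0; apply/eqP.
  have -> : (y0 ^+ 2) ^+ 2 = (y0 * y2) ^+ 2 by rewrite [RHS]exprMn -yy -expr2.
  by rewrite y02 expr0n.
have y2z : y2 = 0 by apply/eqP; rewrite -sqrf_eq0 -yy y0z expr0n.
have aa' : a' = a by rewrite /a /a' y0z; ring.
have dE : d' = d + (s - 1) * y1 ^+ 2 by rewrite /d /d'; ring.
have y1sq : 0 <= (s - 1) * y1 ^+ 2 by rewrite mulr_ge0 ?sqr_ge0 // subr_ge0 ltW.
(* The other order of the factors would give d' < d, as t > 1, whereas d' exceeds d by a nonnegative
   square term. *)
have [d1 d2] : a * d' = k * t /\ a * d = k.
  move: dd'; rewrite aa' => -[[h1 h2]|[h1 h2]]; last by split.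
  suff: false by [].
  have : 0 < k * (t - 1) by rewrite mulr_gt0 // subr_gt0.
  have : 0 <= a * (d' - d) by apply: mulr_ge0; [exact: ltW | lra].
  lra.
have da : d = a.
  by apply: (mulfI (lt0r_neq0 a0)); rewrite d2 -kE aa'.
have e1 : x0 * x2 + z0 * z2 = 0 by move: bz; rewrite y0z; lra.
have e2 : x0 * x1 + z0 * z1 = 0 by move: ez; rewrite y0z; lra.
have e3 : x1 * x2 + z1 * z2 = 0 by move: fz; rewrite y2z; lra.
have n0 : x0 ^+ 2 + z0 ^+ 2 = a by rewrite /a y0z; ring.
have n2 : x2 ^+ 2 + z2 ^+ 2 = a by rewrite -[a]ca y2z; ring.
(* [(x0, z0)] and [(x2, z2)] are an orthogonal basis of the plane, and
   [(x1, z1)] is orthogonal to both. *)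
have det2 : (x0 * z2 - x2 * z0) ^+ 2 = a ^+ 2.
  have -> : (x0 * z2 - x2 * z0) ^+ 2 = (x0 ^+ 2 + z0 ^+ 2) * (x2 ^+ 2 + z2 ^+ 2)
     - (x0 * x2 + z0 * z2) ^+ 2 by ring.
  by rewrite n0 n2 e1; ring.
have detn : x0 * z2 - x2 * z0 != 0.
  by rewrite -sqrf_eq0 det2 sqrf_eq0 lt0r_neq0.
have x1z : x1 = 0.
  apply: (mulfI detn).
  have -> : (x0 * z2 - x2 * z0) * x1 = z2 * (x0 * x1 + z0 * z1)
    - z0 * (x1 * x2 + z1 * z2) by ring.
  by rewrite e2 e3; ring.
have z1z : z1 = 0.
  apply: (mulfI detn).
  have -> : (x0 * z2 - x2 * z0) * z1 = x0 * (x1 * x2 + z1 * z2)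
    - x2 * (x0 * x1 + z0 * z1) by ring.
  by rewrite e2 e3; ring.
have y1a : y1 ^+ 2 = a by rewrite -da /d x1z z1z; ring.
have : a * (a * (s - t)) = 0.
  have -> : a * (a * (s - t)) = a * d' - a * d * t + a * (d + (s - 1) * a - d')
      + a * (a - d) * (1 - t) by ring.
  by rewrite d1 d2 dE y1a da; ring.
by move/eqP; rewrite !mulf_eq0 (gt_eqF a0) /= subr_eq0 => /eqP.
Qed.

(** * Block form of an isomorphism *)

Lemma dotp_evec_eq (R : realType) (n : nat) (A B : 'M[R]_n) :
  (forall i j, dotp (A *m evec j) (evec i) = dotp (B *m evec j) (evec i)) -> A = B.
Proof. by move=> AB; apply/matrixP => i j; rewrite -!dotp_mul_evec. Qed.

Lemma dotp_mull (R : realType) (m n : nat) (A : 'M[R]_(m, n)) u v :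
  dotp (A *m u) v = dotp u (A^T *m v).
Proof. by rewrite /dotp trmx_mul mulmxA. Qed.

(** Nonsingularity makes the brackets span n_2: a nonzero row of [F] would be a nonzero [Z] with
    J(Z) = 0, which is singular since p > 0. *)
Lemma mul_bracket_eq0 (R : realType) (m q p : nat) (mu : skewBilin R q p)
    (F : 'M[R]_(m, q)) :
  (0 < p)%N -> nonsingular mu -> (forall u v, F *m mu u v = 0) -> F = 0.
Proof.
case: p => // p in mu * => _ ns F0; apply/row_matrixP => i; rewrite row0.
apply: trmx_inj; rewrite trmx0; apply/eqP/contraT => /ns.
suff -> : Jop mu (row i F)^T = 0 by rewrite unitmxE det0 unitr0.
apply/matrixP => k l; rewrite !mxE dotpC /dotp trmxK -row_mul F0.
by rewrite !mxE.
Qed.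

Lemma Jop_morph (R : realType) (q q' p p' : nat) (mu : skewBilin R q p)
    (nu : skewBilin R q' p') (A : 'M[R]_(p', p)) (B : 'M[R]_(q', q)) Z :
    (forall u v, B *m mu u v = nu (A *m u) (A *m v)) ->
  Jop mu (B^T *m Z) = A^T *m Jop nu Z *m A.
Proof.
move=> AB; apply: dotp_evec_eq => i j; rewrite Jop_spec -dotp_mull AB.
by rewrite -Jop_spec -!mulmxA [in RHS]dotp_mull trmxK.
Qed.

Lemma Jop_deriv (R : realType) (q p : nat) (mu : skewBilin R q p)
    (A : 'M[R]_p) (B : 'M[R]_q) Z :
    (forall u v, B *m mu u v = mu (A *m u) v + mu u (A *m v)) ->
  Jop mu (B^T *m Z) = Jop mu Z *m A + A^T *m Jop mu Z.
Proof.
move=> AB; apply: dotp_evec_eq => i j; rewrite Jop_spec -dotp_mull AB.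
have dD (u v : 'cV[R]_q) : dotp (u + v) Z = dotp u Z + dotp v Z.
  by rewrite -[u]scale1r dotpPl mul1r scale1r.
rewrite dD -!Jop_spec mulmxDl -[X in _ = dotp (X + _) _]scale1r dotpPl mul1r.
rewrite -!mulmxA. by rewrite [X in _ = _ + X]dotp_mull trmxK.
Qed.

Lemma lie_col0 (R : realType) (q p : nat) (mu : skewBilin R q p) u v :
  lie mu (col_mx u 0) (col_mx v 0) = col_mx 0 (mu u v).
Proof. by rewrite /lie !col_mxKu. Qed.

Lemma lie_isomorphic_blocks (R : realType) (q p : nat) (mu nu : skewBilin R q p) :
    (0 < p)%N -> nonsingular mu -> lie_isomorphic mu nu ->
  exists (A : 'M[R]_p) (B : 'M[R]_q),
    A \in unitmx /\ forall u v, B *m mu u v = nu (A *m u) (A *m v).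
Proof.
move=> p0 ns [phi bij morph].
pose Phi : 'M[R]_(p + q) := \matrix_(i, j) phi (evec j) i 0.
have PhiE u : phi u = Phi *m u.
  rewrite {1}(col_sum_evec u) linear_sum; apply/matrixP => i j; rewrite ord1.
  rewrite summxE mxE; apply: eq_bigr => k _.
  by rewrite linearZ /= !mxE mulrC.
have uPhi : Phi \in unitmx.
  rewrite -unitmx_tr -row_free_unit; apply: inj_row_free => v v0.
  apply: trmx_inj; rewrite trmx0; apply: (bij_inj bij).
  by rewrite linear0 PhiE -[LHS]trmxK trmx_mul trmxK v0 trmx0.
have mE u v : Phi *m col_mx 0 (mu u v) =
    lie nu (Phi *m col_mx u 0) (Phi *m col_mx v 0).
  by rewrite -lie_col0 -!PhiE morph.
move: uPhi; rewrite -[Phi]submxK in mE *.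
move: (ulsubmx Phi) (ursubmx Phi) (dlsubmx Phi) (drsubmx Phi) mE => A F G B mE.
have {}mE u v : F *m mu u v = 0 /\ B *m mu u v = nu (A *m u) (A *m v).
  apply: eq_col_mx; move: (mE u v); rewrite !mul_block_col !mulmx0 !add0r !addr0.
  by rewrite /lie !col_mxKu.
(* The upper right block kills all brackets, because brackets of the target have no n_1 component.
   The isomorphism is thus block triangular and [A] is invertible. *)
have -> : F = 0 by apply: (mul_bracket_eq0 p0 ns) => u v; case: (mE u v).
rewrite unitmxE det_lblock unitrM -!unitmxE => /andP[uA _].
by exists A, B; split => // u v; case: (mE u v).
Qed.

Lemma quartic_ge0 (R : realType) (t x y z : R) : 1 < t -> 0 <= quartic t x y z.
Proof.
move=> t1; rewrite mulr_ge0 // !addr_ge0 ?sqr_ge0 // mulr_ge0 ?sqr_ge0 //.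
by rewrite ltW // (lt_trans ltr01).
Qed.

Lemma lambda_isomorphic_eq (R : realType) (s t : R) : 1 < s -> 1 < t ->
  lie_isomorphic (lambda s) (lambda t) -> s = t.
Proof.
move=> s1 t1 iso.
have [//|A [B [uA AB]]] := lie_isomorphic_blocks _ (lambda_nonsingular s1) iso.
have dA : 0 < `|\det A| by rewrite normr_gt0 -unitfE -unitmxE.
apply: (quartic_rigid s1 t1 dA (C := B^T)) => x y z v.
(* Determinants of [Jop_morph] compare only the squares of the quartics; both are nonnegative, so
   roots can be taken, with factor [|det A|]. *)
have q2 : quartic s (v 0 0) (v 1 0) (v 2 0) ^+ 2 =
    (\det A * quartic t x y z) ^+ 2.
  rewrite -det_Jlambda -Jop_lambda -vec3E (Jop_morph _ AB) Jop_lambda !det_mulmx det_tr.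
  by rewrite mulrAC -expr2 det_Jlambda -exprMn.
apply/eqP; rewrite -(@eqrXn2 _ 2) ?quartic_ge0 //; last first.
  by apply: mulr_ge0; [exact: normr_ge0 | exact: quartic_ge0].
by rewrite q2 [X in X == _]exprMn [X in _ == X]exprMn real_normK ?num_real.
Qed.

(** * Ricci operators in orthonormal bases *)

Lemma dotp_evec (R : realType) (n : nat) (u : 'cV[R]_n) i : dotp u (evec i) = u i 0.
Proof. by rewrite dotpC /dotp /evec trmx_delta -rowE mxE. Qed.

Lemma mxtrace_sum_evec (R : realType) (n : nat) (A : 'M[R]_n) :
  \sum_i (A *m evec i) i 0 = \tr A.
Proof. by apply: eq_bigr => i _; rewrite -colE mxE. Qed.

Lemma mxtrace_skew (R : realType) (n : nat) (S T : 'M[R]_n) :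
  S^T = - S -> T^T = T -> \tr (T *m S) = 0.
Proof.
move=> Ss Ts; have : \tr (T *m S) = - \tr (T *m S); last by lra.
by rewrite -{1}mxtrace_tr trmx_mul Ss Ts mulNmx raddfN /= mxtrace_mulC.
Qed.

(** In an orthonormal basis the operators [K] below have the form A + A^T + S. Products of a
    symmetric and a skew factor have trace zero, which removes the mixed terms. *)
Lemma mxtrace_sym_expand (R : realType) (n : nat) (A B S T : 'M[R]_n) :
    S^T = - S -> T^T = - T -> \tr (A *m B) = 0 ->
  \tr ((A + A^T + S) *m (B + B^T + T)) = 2 * \tr (A *m B^T) + \tr (S *m T).
Proof.
move=> Ss Ts AB.
rewrite !mulmxDl !mulmxDr !raddfD /=.
have -> : \tr (A^T *m B^T) = 0 by rewrite -trmx_mul mxtrace_tr mxtrace_mulC.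
have -> : \tr (A^T *m B) = \tr (A *m B^T).
  by rewrite -mxtrace_tr trmx_mul trmxK mxtrace_mulC.
have -> : \tr (A^T *m T) = - \tr (A *m T).
  by rewrite -mxtrace_tr trmx_mul trmxK Ts mulNmx raddfN /= mxtrace_mulC.
have -> : \tr (S *m B^T) = - \tr (S *m B).
  by rewrite -mxtrace_tr trmx_mul trmxK Ss mulmxN raddfN /= mxtrace_mulC.
rewrite AB; ring.
Qed.

Section OrthonormalRicci.

Variables (R : realType) (n : nat) (br : 'cV[R]_n -> 'cV[R]_n -> 'cV[R]_n).
Hypothesis brl : forall Y, linear (br ^~ Y).
Hypothesis brr : forall X, linear (br X).
Hypothesis br_skew : forall X Y, br Y X = - br X Y.
Variable g : {dot 'cV[R]_n for idfun}.

Definition ad_mx (X : 'cV[R]_n) : 'M[R]_n := \matrix_(i, j) br X (evec j) i 0.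

Hypothesis tr_ad : forall X, \tr (ad_mx X) = 0.
Hypothesis killing0 : forall X Y, \tr (ad_mx X *m ad_mx Y) = 0.

Lemma linear_colE m (f : 'cV[R]_n -> 'cV[R]_m) (u : 'cV[R]_n) : linear f ->
  f u = (\matrix_(i, j) f (evec j) i 0) *m u.
Proof.
move=> lf; pose F := GRing.isLinear.Build _ _ _ _ f lf.
pose h : {linear 'cV[R]_n -> 'cV[R]_m} := HB.pack f F.
rewrite {1}(col_sum_evec u) -[f]/(h : _ -> _) linear_sum.
apply/matrixP => i j; rewrite ord1 summxE mxE; apply: eq_bigr => k _.
by rewrite linearZ /= !mxE mulrC.
Qed.

Lemma ad_mxE X Y : ad_mx X *m Y = br X Y.
Proof. by rewrite [RHS](linear_colE _ (brr X)). Qed.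

Lemma ad_mx_linear : linear ad_mx.
Proof. by move=> a X Y; apply/matrixP => i j; rewrite !mxE brl !mxE. Qed.

Let G := gram g.

Definition br_form (X : 'cV[R]_n) : 'M[R]_n :=
  \matrix_(i, j) g (br (evec j) (evec i)) X.

Lemma br_form_skew X : (br_form X)^T = - br_form X.
Proof. by apply/matrixP => i j; rewrite !mxE br_skew linearNl. Qed.

Lemma dot_sym (u v : 'cV[R]_n) : g u v = g v u.
Proof. by rewrite hermC expr0 mul1r. Qed.

Lemma gram_mulE (A : 'M[R]_n) i j : (G *m A) i j = g (evec i) (A *m evec j).
Proof. by rewrite gformE mulmxA /evec -colE trmx_delta -mulmxA -rowE !mxE. Qed.

Lemma br_formE X Y : br_form Y *m X = (ad_mx X)^T *m G *m Y.
Proof.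
apply/matrixP => i j; rewrite ord1.
have -> : ((ad_mx X)^T *m G *m Y) i 0 = g (br X (evec i)) Y.
  by rewrite gformE -ad_mxE trmx_mul trmx_delta -!mulmxA -rowE !mxE.
have lf : scalar (fun X => g (br X (evec i)) Y).
  by move=> a u v; rewrite brl linearPl.
pose f u : 'cV[R]_1 := const_mx (g (br u (evec i)) Y).
have lf' : linear f by move=> a u v; apply/matrixP => k l; rewrite !mxE lf.
have := congr1 (fun m : 'cV_1 => m 0 0) (linear_colE X lf').
rewrite [in LHS]mxE => ->; rewrite !mxE; apply: eq_bigr => k _.
by rewrite !mxE.
Qed.

(** [cad X] is the [g]-adjoint of [ad_mx X], and [coad X] satisfies g(coad X Y, Z) = g([Y, Z],
    X). *)
Let cad X := invmx G *m (ad_mx X)^T *m G.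
Let coad X := invmx G *m br_form X.

Lemma nablaE X : nabla br g X = 2^-1 *: (ad_mx X - cad X - coad X).
Proof.
have -> : ad_mx X - cad X - coad X =
    invmx G *m (G *m ad_mx X - (ad_mx X)^T *m G - br_form X).
  by rewrite !mulmxBr mulKmx ?gram_unit // !mulmxA.
rewrite scalemxAr /nabla /op_of_form; congr (_ *m _); apply/matrixP => i j.
rewrite [LHS]mxE [RHS]mxE; congr (_ * _).
rewrite [RHS]mxE [X in _ = X + _]mxE gram_mulE ad_mxE.
rewrite [X in _ = _ + X + _]mxE -[(ad_mx X)^T *m G]trmxK trmx_mul trmxK gramT.
rewrite [X in _ = _ - X + _]mxE gram_mulE ad_mxE [X in _ = _ + X]mxE.
rewrite [X in _ = _ + - X]mxE [X in X + _ + _]dot_sym (br_skew X) linearNl.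
by rewrite [g (evec j) _]dot_sym /=; ring.
Qed.

(* [X |-> nabla_X V] is [- K V / 2], so both traces in the definition of the Ricci
   tensor are traces of products of such maps: Ric(Y, Z) = - tr(K_Z K_Y) / 4. *)
Let K V := ad_mx V + cad V + coad V.

Lemma nabla_swap X V : nabla br g X *m V = - 2^-1 *: K V *m X.
Proof.
rewrite nablaE /K scaleNr mulNmx -!scalemxAl -scalerN; congr (_ *: _).
rewrite !mulmxBl !mulmxDl !ad_mxE br_skew !opprD.
have h A B : coad A *m B = cad B *m A.
  by rewrite /coad /cad -mulmxA br_formE !mulmxA.
by rewrite !h addrAC.
Qed.

Lemma tr_K V : \tr (K V) = 0.
Proof.
rewrite /K !raddfD /= tr_ad /cad mxtrace_mulC mulmxA mulmxV ?gram_unit // mul1mx.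
rewrite mxtrace_tr tr_ad /coad mxtrace_skew ?br_form_skew ?trmx_inv ?gramT //.
by rewrite !addr0.
Qed.

Lemma ricci_tensorE Y Z : ricci_tensor br g Y Z = - 4^-1 * \tr (K Z *m K Y).
Proof.
(* By [nabla_swap] each term of R(X, Y) Z is an endomorphism applied to X. The first is traceless by
   [tr_K]; the other two combine through ad Y - nabla Y = K Y / 2. *)
have -> : ricci_tensor br g Y Z = \tr (- 2^-1 *: K (nabla br g Y *m Z)
    - nabla br g Y *m (- 2^-1 *: K Z) + (- 2^-1 *: K Z) *m ad_mx Y).
  rewrite -mxtrace_sum_evec /ricci_tensor; apply: eq_bigr => i _.
  have -> : curvature br g (evec i) Y *m Z =
      nabla br g (evec i) *m (nabla br g Y *m Z)
      - nabla br g Y *m (nabla br g (evec i) *m Z)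
      - nabla br g (br (evec i) Y) *m Z.
    by rewrite /curvature !mulmxBl !mulmxA.
  rewrite (nabla_swap _ (nabla br g Y *m Z)) !(nabla_swap _ Z) br_skew -ad_mxE.
  by rewrite mulmxN opprK !mulmxDl mulNmx !mulmxA.
rewrite 2!mxtraceD mxtraceZ tr_K mulr0 add0r -mulmxN mxtrace_mulC mulNmx -mulmxN.
rewrite -mxtraceD -mulmxDr addrC nablaE.
have -> : ad_mx Y - 2^-1 *: (ad_mx Y - cad Y - coad Y) = 2^-1 *: K Y.
  apply/matrixP => i j; rewrite /K; move: (ad_mx Y) (cad Y) (coad Y) => a b c.
  by rewrite !mxE; field.
by rewrite -scalemxAl -scalemxAr !linearZ /= mulrA; congr (_ * _); field.
Qed.

Variable P : 'M[R]_n.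
Hypothesis P_orth : P^T *m G *m P = 1%:M.

Let f a := P *m evec a.
Definition struct_mx a : 'M[R]_n := \matrix_(i, j) (invmx P *m br (f a) (f j)) i 0.

Lemma orth_unit : P \in unitmx.
Proof. by have [] := mulmx1_unit P_orth. Qed.

Lemma orth_invmx : invmx P = P^T *m G.
Proof. by rewrite -[RHS]mulmx1 -(mulmxV orth_unit) mulmxA P_orth mul1mx. Qed.

Lemma orth_gram_inv : invmx G = P *m P^T.
Proof.
rewrite -[RHS]mulmx1 -(mulmxV (gram_unit g)) -/G mulmxA -[_ *m P^T *m G]mulmxA.
by rewrite -orth_invmx mulmxV ?orth_unit // mul1mx.
Qed.

Lemma struct_mxE a : struct_mx a = invmx P *m ad_mx (f a) *m P.
Proof.
apply/matrixP => i j; rewrite -[RHS]dotp_mul_evec -!mulmxA ad_mxE.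
by rewrite [LHS]mxE dotp_evec.
Qed.

Let S a : 'M[R]_n := \matrix_(i, j) struct_mx j a i.

Lemma br_form_conj a : P^T *m br_form (f a) *m P = S a.
Proof.
apply/matrixP => i j; rewrite [RHS]mxE -[LHS]dotp_mul_evec -!mulmxA br_formE !mulmxA.
have -> : P^T *m (ad_mx (f j))^T *m G = (struct_mx j)^T *m invmx P.
  rewrite struct_mxE orth_invmx !trmx_mul trmxK gramT -!mulmxA; congr (_ *m _).
  by rewrite -/G -orth_invmx mulmxV ?orth_unit // mulmx1.
by rewrite -!mulmxA mulKmx ?orth_unit // dotp_mul_evec mxE.
Qed.

(** Conjugation by [P] turns K (f a) into [struct_mx a], its transpose and the skew matrix [S a].
    The vanishing Killing form allows [mxtrace_sym_expand], whose two terms give the two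
    summands. *)
Lemma ricci_operator_orth i j :
  (invmx P *m ricci_operator br g *m P) i j =
  - 2^-1 * \tr (struct_mx i *m (struct_mx j)^T)
  + 4^-1 * (\sum_a struct_mx a *m (struct_mx a)^T) i j.
Proof.
rewrite /ricci_operator /op_of_form orth_gram_inv !mulmxA mulVmx ?orth_unit // mul1mx.
rewrite -/G.
have Kconj a : invmx P *m K (f a) *m P = struct_mx a + (struct_mx a)^T + S a.
  rewrite /K !mulmxDr !mulmxDl -struct_mxE -br_form_conj; congr (_ + _ + _).
    rewrite struct_mxE /cad !trmx_mul orth_gram_inv -!mulmxA mulKmx ?orth_unit //.
    by rewrite orth_invmx trmx_mul trmxK gramT.
  by rewrite /coad orth_gram_inv -!mulmxA mulKmx ?orth_unit.
have Sskew a : (S a)^T = - S a.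
  rewrite -br_form_conj !trmx_mul trmxK br_form_skew.
  by rewrite mulNmx mulmxN mulmxA.
have K_linear : linear K.
  move=> c X Y; rewrite /K /cad /coad.
  have -> : br_form (c *: X + Y) = c *: br_form X + br_form Y.
    by apply/matrixP => k l; rewrite !mxE linearPr.
  rewrite ad_mx_linear linearP !mulmxDr !mulmxDl -!scalemxAr -!scalemxAl.
  by rewrite !scalerDr; apply/matrixP => k l; rewrite !mxE; ring.
set M := \matrix_(k, l) _.
have <- : ricci_tensor br g (f j) (f i) = (P^T *m M *m P) i j.
  rewrite (form_colE (b := fun Z Y => ricci_tensor br g Y Z)).
  - by rewrite -[RHS]dotp_mul_evec dotpC /dotp trmx_mul !mulmxA.
  - move=> Z c X Y; rewrite !ricci_tensorE K_linear mulmxDl mxtraceD.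
    by rewrite -scalemxAl mxtraceZ mulrDr mulrCA.
  - move=> Z c X Y; rewrite !ricci_tensorE K_linear mulmxDr mxtraceD.
    by rewrite -scalemxAr mxtraceZ mulrDr mulrCA.
have trK : \tr (K (f i) *m K (f j)) =
    \tr ((invmx P *m K (f i) *m P) *m (invmx P *m K (f j) *m P)).
  rewrite -!mulmxA mulKVmx ?orth_unit // [RHS]mxtrace_mulC !mulmxA mulmxK //.
  exact: orth_unit.
rewrite ricci_tensorE trK !Kconj mxtrace_sym_expand ?Sskew //; last first.
  rewrite !struct_mxE -!mulmxA mulKVmx ?orth_unit // mxtrace_mulC !mulmxA mulmxK.
    exact: killing0.
  exact: orth_unit.
have -> : \tr (S i *m S j) = - (\sum_a struct_mx a *m (struct_mx a)^T) i j.
  rewrite -[S j]opprK -Sskew mulmxN raddfN /= summxE; congr (- _).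
  rewrite /mxtrace; under eq_bigr do rewrite mxE.
  rewrite exchange_big /=; apply: eq_bigr => a _; rewrite mxE.
  by apply: eq_bigr => b _; rewrite !mxE.
by field.
Qed.

End OrthonormalRicci.

(** * Skew tensors and their derivations *)

Lemma mxtrace_sqr_sym (R : realType) (n : nat) (A : 'M[R]_n) : A^T = A ->
  \tr (A *m A) = \sum_i \sum_j A i j ^+ 2.
Proof.
move=> As; rewrite /mxtrace; apply: eq_bigr => i _; rewrite mxE.
by apply: eq_bigr => j _; rewrite -{2}As mxE expr2.
Qed.

Lemma sum_sqr_ge0 (R : realType) (m n : nat) (A : 'M[R]_(m, n)) :
  0 <= \sum_i \sum_j A i j ^+ 2.
Proof. by apply: sumr_ge0 => i _; apply: sumr_ge0 => j _; exact: sqr_ge0. Qed.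

Lemma sum_sqr_eq0 (R : realType) (m n : nat) (A : 'M[R]_(m, n)) :
  \sum_i \sum_j A i j ^+ 2 = 0 -> A = 0.
Proof.
move=> A0; apply/matrixP => i j; rewrite mxE; apply/eqP; rewrite -sqrf_eq0.
have /psumr_eq0P : forall i, true -> 0 <= \sum_j A i j ^+ 2.
  by move=> k _; apply: sumr_ge0 => l _; exact: sqr_ge0.
move=> /(_ A0 i isT) /psumr_eq0P => /(_ (fun _ _ => sqr_ge0 _)) /(_ j isT) ->.
by [].
Qed.

Section SkewTensor.

(** [M a k b] models the k-th coordinate of the bracket of the a-th and b-th vectors of an adapted
    orthonormal basis. *)
Variables (R : realType) (p q : nat) (M : 'I_p -> 'M[R]_(q, p)).
Hypothesis M_skew : forall a b k, M a k b = - M b k a.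

Let X := \sum_a (M a)^T *m M a.
Let Y := \sum_a M a *m (M a)^T.

Lemma skew_tensor_trmul a b : \tr ((M a)^T *m M b) = X a b.
Proof.
rewrite /X summxE /mxtrace; apply: eq_bigr => i _; rewrite !mxE.
by apply: eq_bigr => k _; rewrite !mxE (M_skew a) (M_skew b) mulrNN.
Qed.

(* The Ricci operator [(- X / 2, Y / 4)] is trace-orthogonal to derivations. *)
Lemma skew_tensor_deriv (A : 'M[R]_p) (B : 'M[R]_q) :
    (forall a, B *m M a = M a *m A + \sum_b A b a *: M b) ->
  2 * \tr (X *m A) = \tr (Y *m B).
Proof.
move=> dAB; suff : \tr (X *m A) = \tr (Y *m B) - \tr (X *m A) by lra.
(* The derivation identity replaces [M a *m A]; by skewness the extra sum is again tr(X A) after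
   summation over [a]. *)
have term a : \tr ((M a)^T *m M a *m A) =
    \tr (M a *m (M a)^T *m B) - \sum_b X a b * A b a.
  rewrite -mulmxA -[M a *m A](addrK (\sum_b A b a *: M b)) -dAB mulmxBr raddfB /=.
  congr (_ - _); first by rewrite [LHS]mxtrace_mulC -[in LHS]mulmxA [LHS]mxtrace_mulC.
  rewrite mulmx_sumr raddf_sum /=; apply: eq_bigr => b _.
  by rewrite -scalemxAr mxtraceZ skew_tensor_trmul mulrC.
have XA : \sum_a \sum_b X a b * A b a = \tr (X *m A).
  by rewrite /mxtrace; apply: eq_bigr => a _; rewrite mxE.
rewrite -{2}XA; have -> : \tr (Y *m B) = \sum_a \tr (M a *m (M a)^T *m B).
  by rewrite /Y mulmx_suml raddf_sum.
by rewrite -sumrB /X mulmx_suml raddf_sum; apply: eq_bigr => a _; exact: term.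
Qed.

Lemma skew_tensor_nilsoliton (A : 'M[R]_p) (B : 'M[R]_q) (c beta : R) :
    (forall a, B *m M a = M a *m A + \sum_b A b a *: M b) ->
    A = - c%:M - 2^-1 *: X -> B = - c%:M + 4^-1 *: Y ->
    \tr A = beta / 2 * p%:R -> \tr B = beta * q%:R ->
  A = (beta / 2)%:M.
Proof.
move=> dAB AE BE trA trB; pose A' := A - (beta / 2)%:M; pose B' := B - beta%:M.
have dAB' a : B' *m M a = M a *m A' + \sum_b A' b a *: M b.
  rewrite mulmxBl mulmxBr dAB mul_scalar_mx mul_mx_scalar.
  have -> : \sum_b A' b a *: M b = \sum_b A b a *: M b - (beta / 2) *: M a.
    rewrite [X in _ - X](_ : _ = \sum_b (beta / 2)%:M b a *: M b).
      by rewrite -sumrB; apply: eq_bigr => b _; rewrite -scalerBl !mxE.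
    rewrite (bigD1 a) //= big1 ?addr0 => [|b ba]; rewrite mxE ?eqxx ?mulr1n //.
    by rewrite (negPf ba) mulr0n scale0r.
  by apply/matrixP => i j; rewrite !mxE; field.
have Xs : X^T = X.
  by rewrite /X linear_sum /=; apply: eq_bigr => a _; rewrite trmx_mul trmxK.
have Ys : Y^T = Y.
  by rewrite /Y linear_sum /=; apply: eq_bigr => a _; rewrite trmx_mul trmxK.
have As : A'^T = A' by rewrite /A' AE !linearB /= linearN linearZ /= !tr_scalar_mx Xs.
have Bs : B'^T = B'.
  by rewrite /B' BE linearB linearD /= linearN linearZ /= !tr_scalar_mx Ys.
have trA' : \tr A' = 0 by rewrite /A' raddfB /= trA mxtrace_scalar mulr_natr subrr.
have trB' : \tr B' = 0 by rewrite /B' raddfB /= trB mxtrace_scalar mulr_natr subrr.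
have A'E : A' = A - (beta / 2)%:M by [].
have B'E : B' = B - beta%:M by [].
clearbody A' B'.
(* By [skew_tensor_deriv] the traces of A'^2 and B'^2 are opposite; both are sums of squares, so
   they vanish. *)
have A2 : \tr (A' *m A') = - 2^-1 * \tr (X *m A').
  rewrite {1}A'E AE !mulmxBl mulNmx !mul_scalar_mx -scalemxAl !raddfB raddfN /=.
  by rewrite !mxtraceZ trA'; ring.
have B2 : \tr (B' *m B') = 4^-1 * \tr (Y *m B').
  rewrite {1}B'E BE mulmxBl mulmxDl mulNmx !mul_scalar_mx -scalemxAl.
  by rewrite raddfB raddfD raddfN /= !mxtraceZ trB'; ring.
have XY := skew_tensor_deriv dAB'.
have A0 : \sum_i \sum_j A' i j ^+ 2 = 0.
  apply/eqP; rewrite eq_le sum_sqr_ge0 andbT -mxtrace_sqr_sym //.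
  have := sum_sqr_ge0 B'; rewrite -mxtrace_sqr_sym // A2 B2; lra.
by apply/eqP; rewrite -subr_eq0 -A'E; apply/eqP/sum_sqr_eq0.
Qed.

End SkewTensor.

(** * Adapted orthonormal bases *)

Definition posdef {R : realType} {n : nat} (G : 'M[R]_n) : Prop :=
  G^T = G /\ forall v : 'cV[R]_n, v != 0 -> 0 < (v^T *m G *m v) 0 0.

Lemma posdef_gram (R : realType) (n : nat) (g : {dot 'cV[R]_n for idfun}) :
  posdef (gram g).
Proof. by split=> [|v v0]; [exact: gramT | rewrite -gformE neq0_dnorm_gt0]. Qed.

Lemma posdef_conj (R : realType) (m n : nat) (G : 'M[R]_n) (Q : 'M[R]_(n, m)) :
  posdef G -> (forall v : 'cV[R]_m, Q *m v = 0 -> v = 0) -> posdef (Q^T *m G *m Q).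
Proof.
move=> [Gs Gp] Q_inj; split=> [|v v0]; first by rewrite !trmx_mul trmxK Gs mulmxA.
have -> : v^T *m (Q^T *m G *m Q) *m v = (Q *m v)^T *m G *m (Q *m v).
  by rewrite trmx_mul !mulmxA.
by apply: Gp; apply: contra_neq v0; exact: Q_inj.
Qed.

Lemma posdef_unit (R : realType) (n : nat) (G : 'M[R]_n) : posdef G -> G \in unitmx.
Proof.
move=> [_ Gp]; rewrite -row_free_unit; apply: inj_row_free => v v0; apply/eqP.
apply: contraT => vN0; have := Gp v^T; rewrite trmxK v0 mul0mx mxE ltxx; apply.
by rewrite -trmx0 (inj_eq trmx_inj).
Qed.

Lemma posdef_drsubmx (R : realType) (m n : nat) (G : 'M[R]_(m + n)) :
  posdef G -> posdef (drsubmx G).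
Proof.
move=> Gp; pose Q : 'M[R]_(m + n, n) := col_mx 0 1%:M.
have -> : drsubmx G = Q^T *m G *m Q.
  rewrite -{2}[G]submxK /Q tr_col_mx mul_row_block trmx0 trmx1 !mul0mx !add0r.
  by rewrite !mul1mx mul_row_col mulmx0 add0r mulmx1.
apply: posdef_conj => // v; rewrite mul_col_mx mul0mx mul1mx -(col_mx0 _ m n 1).
by move/eq_col_mx => [].
Qed.

(* The Schur complement [S] is the Gram matrix of the orthogonal projections of
   the first [m] basis vectors to the complement of the last [n] ones. *)
Lemma posdef_block_orth (R : realType) (m n : nat) (G : 'M[R]_(m + n)) :
    posdef G ->
  exists2 S : 'M[R]_m, posdef S &
    forall P1 P2, P1^T *m S *m P1 = 1%:M -> P2^T *m drsubmx G *m P2 = 1%:M ->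
    exists P21, let P : 'M[R]_(m + n) := block_mx P1 0 P21 P2 in
      P^T *m G *m P = 1%:M.
Proof.
move=> Gp; have Du := posdef_unit (posdef_drsubmx Gp).
move: Gp Du; rewrite -[G]submxK block_mxKdr.
move: (ulsubmx G) (ursubmx G) (dlsubmx G) (drsubmx G) => A B C D {G} Gp Du.
have [Gs _] := Gp; rewrite tr_block_mx in Gs.
have [_ _ BC Ds] := eq_block_mx Gs.
(* The columns of (1; H) are the first [m] basis vectors projected orthogonally to the last [n]. *)
pose H := - (invmx D *m C).
have CH : C + D *m H = 0 by rewrite mulmxN mulKVmx // subrr.
have BH : B + H^T *m D = 0.
  by apply: trmx_inj; rewrite trmx0 linearD /= trmx_mul trmxK BC Ds.
have SE : A + B *m H = (col_mx 1%:M H)^T *m block_mx A B C D *m col_mx 1%:M H.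
  rewrite -mulmxA mul_block_col !mulmx1 CH tr_col_mx trmx1 mul_row_col.
  by rewrite mul1mx mulmx0 addr0.
exists (A + B *m H).
  rewrite SE; apply: posdef_conj => // v; rewrite mul_col_mx mul1mx -(col_mx0 _ m n 1).
  by move/eq_col_mx => [].
move=> P1 P2 P1S P2D; exists (H *m P1).
rewrite /= tr_block_mx -mulmxA mulmx_block !mulmx0 !add0r !mulmxA -!mulmxDl CH.
rewrite !mul0mx mulmx_block !trmx0 !mul0mx !mulmx0 !add0r !addr0 !mulmxA P1S P2D.
rewrite trmx_mul -mulmxDl -mulmxA -mulmxDr BH mulmx0 mul0mx -scalar_mx_block //.
Qed.

(** Gram-Schmidt by induction: the first vector is made orthogonal to the others and scaled by the
    square root of its 1 x 1 Schur complement. *)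
Lemma posdef_orth (R : realType) (n : nat) (G : 'M[R]_n) :
  posdef G -> exists P : 'M[R]_n, P^T *m G *m P = 1%:M.
Proof.
elim: n G => [|n IHn] G Gp; first by exists 0; apply/matrixP => -[].
have [S [_ Sp] extend] := @posdef_block_orth R 1 n G Gp.
have [P2 P2E] := IHn _ (posdef_drsubmx (Gp : @posdef R (1 + n) G)).
have S0 : 0 < S 0 0.
  have := Sp 1%:M (oner_neq0 _); rewrite trmx1 mul1mx mulmx1; apply.
have [|P21 PE] := extend (Num.sqrt (S 0 0))^-1%:M P2 _ P2E; last first.
  by exists (block_mx (Num.sqrt (S 0 0))^-1%:M 0 P21 P2).
rewrite tr_scalar_mx mul_scalar_mx mul_mx_scalar scalerA -invfM -expr2.
rewrite sqr_sqrtr ?ltW // [S]mx11_scalar scale_scalar_mx mxE eqxx mulr1n.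
by rewrite mulVf ?lt0r_neq0.
Qed.

(** * Nilsolitons on 2-step nilpotent algebras *)

Section LieRicci.

Variables (R : realType) (q p : nat) (mu : skewBilin R q p).

Lemma lie_linearl Y : linear ((lie mu) ^~ Y).
Proof.
move=> a X X'; rewrite /lie linearP linearPl /= scale_col_mx add_col_mx.
by rewrite scaler0 addr0.
Qed.

Lemma lie_linearr X : linear (lie mu X).
Proof.
move=> a Y Y'; rewrite /lie linearP linearPr /= scale_col_mx add_col_mx.
by rewrite scaler0 addr0.
Qed.

Lemma lie_skew X Y : lie mu Y X = - lie mu X Y.
Proof. by rewrite /lie sbmap_skew opp_col_mx oppr0. Qed.

Lemma lie_col0r X (w : 'cV[R]_q) : lie mu X (col_mx 0 w) = 0.
Proof. by rewrite /lie col_mxKu linear0r col_mx0. Qed.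

Lemma evec_rshift (i : 'I_q) : evec (rshift p i) = col_mx 0 (evec i) :> 'cV[R]_(p + q).
Proof.
apply/matrixP => k l; rewrite ord1; case: (split_ordP k) => j ->.
  by rewrite col_mxEu !mxE eq_lrshift.
by rewrite col_mxEd !mxE eq_rshift.
Qed.

Lemma evec_lshift (i : 'I_p) : evec (lshift q i) = col_mx (evec i) 0 :> 'cV[R]_(p + q).
Proof.
apply/matrixP => k l; rewrite ord1; case: (split_ordP k) => j ->.
  by rewrite col_mxEu !mxE eq_lshift.
by rewrite col_mxEd !mxE eq_rlshift.
Qed.

Lemma lie_ad_trace X : \tr (ad_mx (lie mu) X) = 0.
Proof.
rewrite /mxtrace big_split_ord /= !big1 ?addr0 // => i _; rewrite mxE.
  by rewrite evec_rshift lie_col0r mxE.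
by rewrite /lie col_mxEu mxE.
Qed.

Lemma lie_killing0 X Y : \tr (ad_mx (lie mu) X *m ad_mx (lie mu) Y) = 0.
Proof.
suff -> : ad_mx (lie mu) X *m ad_mx (lie mu) Y = 0 by rewrite raddf0.
apply/matrixP => i j; rewrite -dotp_mul_evec -mulmxA.
by rewrite !(ad_mxE lie_linearr) lie_col0r dotp_evec !mxE.
Qed.

Lemma mulmx_evec_inj m n (A B : 'M[R]_(m, n)) :
  (forall b, A *m evec b = B *m evec b) -> A = B.
Proof.
move=> AB; apply/matrixP => i j; have := congr1 (fun v : 'cV_m => v i 0) (AB j).
by rewrite /evec -!colE !mxE.
Qed.

Variables (g : {dot 'cV[R]_(p + q) for idfun}).
Variables (P1 : 'M[R]_p) (P2 : 'M[R]_q) (P21 : 'M[R]_(q, p)).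
Let P : 'M[R]_(p + q) := block_mx P1 0 P21 P2.
Hypothesis P_orth : P^T *m gram g *m P = 1%:M.

(** Structure constants in the orthonormal basis given by the columns of [P]; its zero block places
    the last [q] vectors in n_2. *)
Definition bracket_tensor (a : 'I_p) : 'M[R]_(q, p) :=
  \matrix_(k, b) (invmx P2 *m mu (P1 *m evec a) (P1 *m evec b)) k 0.

Let P1P2u : P1 \in unitmx /\ P2 \in unitmx.
Proof.
have := orth_unit P_orth.
by rewrite unitmxE det_lblock unitrM -!unitmxE => /andP.
Qed.

Let invP : invmx P = block_mx (invmx P1) 0 (- (invmx P2 *m P21 *m invmx P1)) (invmx P2).
Proof.
have [u1 u2] := P1P2u; set Q := block_mx (invmx P1) _ _ _.
have QP : Q *m P = 1%:M.
  rewrite /Q /P mulmx_block !mulmx0 !mul0mx !addr0 !add0r mulNmx !mulVmx // mulmxKV //.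
  by rewrite addNr -scalar_mx_block.
by rewrite -[RHS]mulmx1 -(mulmxV (orth_unit P_orth)) mulmxA QP mul1mx.
Qed.

Lemma bracket_tensorE a v :
  bracket_tensor a *m v = invmx P2 *m mu (P1 *m evec a) (P1 *m v).
Proof.
have lf : linear (fun v => invmx P2 *m mu (P1 *m evec a) (P1 *m v)).
  by move=> c u w; rewrite linearP linearPr linearP.
by rewrite [RHS](linear_colE _ lf); congr (_ *m _); apply/matrixP => i j; rewrite !mxE.
Qed.

Lemma bracket_tensor_skew a b k : bracket_tensor a k b = - bracket_tensor b k a.
Proof. by rewrite [LHS]mxE [in RHS]mxE sbmap_skew mulmxN mxE. Qed.

Lemma orth_lie X Y : invmx P *m lie mu (P *m X) (P *m Y) =
  col_mx 0 (invmx P2 *m mu (P1 *m usubmx X) (P1 *m usubmx Y)).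
Proof.
rewrite -{1}[X]vsubmxK -{1}[Y]vsubmxK invP /lie /P !mul_block_col !mul0mx !addr0.
by rewrite !col_mxKu !mulmx0 !add0r.
Qed.

Lemma struct_mx_lieE a i j : struct_mx (lie mu) P a i j =
  col_mx 0 (invmx P2 *m mu (P1 *m usubmx (evec a)) (P1 *m usubmx (evec j))) i 0.
Proof. by rewrite mxE orth_lie. Qed.

Lemma struct_mx_lshift a :
  struct_mx (lie mu) P (lshift q a) = block_mx 0 0 (bracket_tensor a) 0.
Proof.
rewrite -[LHS]submxK; congr block_mx; apply/matrixP => i j;
  rewrite [LHS]mxE [LHS]mxE struct_mx_lieE !evec_lshift ?evec_rshift !col_mxKu.
- by rewrite col_mxEu !mxE.
- by rewrite col_mxEu !mxE.
- by rewrite col_mxEd [RHS]mxE.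
- by rewrite col_mxEd mulmx0 linear0r mulmx0 !mxE.
Qed.

Lemma struct_mx_rshift a : struct_mx (lie mu) P (rshift p a) = 0.
Proof.
apply/matrixP => i j; rewrite struct_mx_lieE evec_rshift col_mxKu mulmx0 linear0l.
by rewrite mulmx0 col_mx0 !mxE.
Qed.

Let M := bracket_tensor.

Lemma ricci_orth_blocks :
  invmx P *m ricci_operator (lie mu) g *m P =
  block_mx (- 2^-1 *: \sum_a (M a)^T *m M a) 0 0 (4^-1 *: \sum_a M a *m (M a)^T).
Proof.
have ricE := ricci_operator_orth lie_linearl lie_linearr lie_skew lie_ad_trace
  lie_killing0 P_orth.
have sumE : \sum_a struct_mx (lie mu) P a *m (struct_mx (lie mu) P a)^T =
    block_mx 0 0 0 (\sum_a M a *m (M a)^T).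
  rewrite big_split_ord /= [X in _ + X]big1 ?addr0 => [|a _]; last first.
    by rewrite struct_mx_rshift mul0mx.
  under eq_bigr do rewrite struct_mx_lshift tr_block_mx mulmx_block
    !trmx0 !mul0mx !mulmx0 !addr0.
  apply: (big_ind2 (fun A B => A = block_mx 0 0 0 B)) => [|A B A' B' -> ->|//].
    by rewrite block_mx0.
  by rewrite add_block_mx !addr0.
rewrite -[LHS]submxK; congr block_mx; apply/matrixP => i j;
  rewrite [LHS]mxE [LHS]mxE ricE
  ?struct_mx_lshift ?struct_mx_rshift sumE.
- rewrite block_mxEul [X in _ + _ * X]mxE mulr0 addr0 tr_block_mx mulmx_block !trmx0.
  rewrite !mul0mx !mulmx0 !addr0 mxtrace_block mxtrace0 add0r [RHS]mxE.
  rewrite mxtrace_mulC -mxtrace_tr trmx_mul trmxK.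
  by rewrite (skew_tensor_trmul bracket_tensor_skew).
- by rewrite block_mxEur trmx0 mulmx0 mxtrace0 !mxE !mulr0 addr0.
- by rewrite block_mxEdl mul0mx mxtrace0 !mxE !mulr0 addr0.
- by rewrite block_mxEdr mul0mx mxtrace0 !mxE mulr0 add0r.
Qed.

Lemma derivation_blocks (D : 'M[R]_(p + q)) : derivation mu D -> forall u v,
  ursubmx D *m mu u v = 0 /\
  drsubmx D *m mu u v = mu (ulsubmx D *m u) v + mu u (ulsubmx D *m v).
Proof.
move=> dD u v; have := dD (col_mx u 0) (col_mx v 0); rewrite lie_col0.
rewrite -{1 2 3}[D]submxK !mul_block_col !mulmx0 !add0r !addr0 /lie !col_mxKu.
by rewrite add_col_mx addr0 => /eq_col_mx.
Qed.

Lemma nilsoliton_bracket_tensor (c beta : R) (D : 'M[R]_(p + q)) :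
    derivation mu D -> ricci_operator (lie mu) g = c%:M + D -> ursubmx D = 0 ->
    \tr (ulsubmx D) = beta / 2 * p%:R -> \tr (drsubmx D) = beta * q%:R ->
  exists kappa, \sum_a (M a)^T *m M a = kappa%:M.
Proof.
move=> dD ricE D12 trA trB; have [u1 u2] := P1P2u.
pose A := invmx P1 *m ulsubmx D *m P1; pose B := invmx P2 *m drsubmx D *m P2.
have := ricci_orth_blocks; rewrite ricE mulmxDr mulmxDl mul_mx_scalar -scalemxAl.
rewrite mulVmx ?(orth_unit P_orth) // -[D]submxK D12 invP /P.
rewrite !mulmx_block !mulmx0 !mul0mx !addr0 !add0r scalemx1 scalar_mx_block.
rewrite !mul0mx !addr0 add_block_mx => /eq_block_mx[AE _ _ BE].
rewrite -/A -/B in AE BE.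
have trA' : \tr A = beta / 2 * p%:R by rewrite /A mxtrace_mulC mulmxA mulmxV // mul1mx.
have trB' : \tr B = beta * q%:R by rewrite /B mxtrace_mulC mulmxA mulmxV // mul1mx.
have PA v : P1 *m (A *m v) = ulsubmx D *m (P1 *m v) by rewrite /A -!mulmxA mulKVmx.
have PB w : B *m (invmx P2 *m w) = invmx P2 *m (drsubmx D *m w).
  by rewrite /B -!mulmxA mulKVmx.
(* The constant solves - c - X / 2 = beta / 2 for X. *)
clearbody A B; exists (- (beta + 2 * c)).
have dAB a : B *m M a = M a *m A + \sum_b A b a *: M b.
  apply: mulmx_evec_inj => b; rewrite mulmxDl -!mulmxA !bracket_tensorE PA PB.
  rewrite (derivation_blocks dD _ _).2 mulmxDr addrC.
  congr (_ + _); rewrite -PA [A *m evec a]col_sum_evec mulmx_sumr.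
  rewrite linear_sumlz mulmx_sumr mulmx_suml /=; apply: eq_bigr => d _.
  rewrite -scalemxAl bracket_tensorE -scalemxAr linearZl_LR linearZ /=.
  by rewrite -dotp_evec dotp_mul_evec.
have AE' : A = - c%:M - 2^-1 *: \sum_a (M a)^T *m M a.
  by rewrite -scaleNr -AE addKr.
have BE' : B = - c%:M + 4^-1 *: \sum_a M a *m (M a)^T by rewrite -BE addKr.
have := skew_tensor_nilsoliton bracket_tensor_skew dAB AE' BE' trA' trB'.
rewrite AE' => XE; apply/matrixP => i j.
have := congr1 (fun N : 'M_p => N i j) XE; rewrite !mxE.
case: (i == j); rewrite ?mulr1n ?mulr0n; lra.
Qed.

End LieRicci.

(* The vectors [b] of each half contribute the same total to [sum |M_a e_b|^2]; the
   mixed terms agree by skewness, hence so do the two diagonal ones. *)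
Lemma isotropic_complement (R : realType) (m q : nat)
    (M : 'I_(m + m) -> 'M[R]_(q, m + m))
    (kappa : R) :
    (forall a b k, M a k b = - M b k a) ->
    \sum_a (M a)^T *m M a = kappa%:M ->
    (forall a b k, M (rshift m a) k (rshift m b) = 0) ->
  forall a b k, M (lshift m a) k (lshift m b) = 0.
Proof.
move=> skew sumM W0; pose n a b := \sum_k M a k b ^+ 2.
have nC a b : n a b = n b a by apply: eq_bigr => k _; rewrite skew sqrrN.
have n0 a b : 0 <= n a b by apply: sumr_ge0 => k _; exact: sqr_ge0.
have nK b : \sum_a n a b = kappa.
  have := congr1 (fun A : 'M_(m + m) => A b b) sumM.
  rewrite !mxE eqxx mulr1n summxE => <-.
  by apply: eq_bigr => a _; rewrite mxE; apply: eq_bigr => k _; rewrite mxE expr2.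
have sumU : \sum_b \sum_a n (lshift m a) (lshift m b) = 0.
  have eU : \sum_b \sum_a n a (lshift m b) = \sum_b \sum_a n a (rshift m b).
    by apply: eq_bigr => b _; rewrite !nK.
  have split_n b : \sum_a n a b = \sum_a n (lshift m a) b + \sum_a n (rshift m a) b.
    exact: big_split_ord.
  have W1 b : \sum_a n (rshift m a) (rshift m b) = 0.
    by apply: big1 => a _; apply: big1 => k _; rewrite W0 expr0n.
  move: eU; under eq_bigr do rewrite split_n; rewrite big_split /=.
  under [X in _ = X]eq_bigr do rewrite split_n W1 addr0.
  rewrite [X in _ = X]exchange_big /=; under [X in _ = X]eq_bigr do
    under eq_bigr do rewrite nC.
  by move=> /eqP; rewrite -subr_eq0 addrK => /eqP.
move=> a b k; apply/eqP; rewrite -sqrf_eq0; apply/eqP.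
have n0U : n (lshift m a) (lshift m b) = 0.
  have/psumr_eq0P := sumU; move/(_ (fun b _ => sumr_ge0 _ (fun a _ => n0 _ _))).
  move=> /(_ b isT) /psumr_eq0P; move/(_ (fun a _ => n0 _ _)); exact.
by have/psumr_eq0P := n0U; move/(_ (fun k _ => sqr_ge0 _)); exact.
Qed.

(** * Non-existence of nilsolitons *)

Definition offdiag_block_inv {R : realType} (t : R) (k : 'I_3) : 'M[R]_4 :=
  \matrix_(i, j) nth 0 (nth [::] (nth [::]
  [:: [:: [:: -1; 0; 0; 0]; [:: 0; -1; 0; 0]; [:: 0; 0; -1; 0]; [:: 0; 0; 0; -1]];
      [:: [:: 0; t^-1; 0; 0]; [:: -1; 0; 0; 0]; [:: 0; 0; 0; 1]; [:: 0; 0; -1; 0]];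
      [:: [:: 0; 0; 0; 1]; [:: 0; 0; 1; 0]; [:: 0; -1; 0; 0]; [:: -1; 0; 0; 0]]]
   k) i) j.

Lemma offdiag_block_invK (R : realType) (t : R) k : t != 0 ->
  offdiag_block_inv t k *m
    offdiag_block t (k == 0)%:R (k == 1)%:R (k == 2)%:R = 1%:M.
Proof.
move=> t0; apply/matrixP => i j; rewrite !mxE !big_ord_recl big_ord0 !mxE.
case: k => [[|[|[|//]]] Hk]; case: i => [[|[|[|[|//]]]] Hi];
  case: j => [[|[|[|[|//]]]] Hj]; rewrite /= ?mulr1n ?mulr0n; by field.
Qed.

Lemma tr_offdiag_block_inv (R : realType) (t : R) k (x y z : R) : t != 0 ->
  \tr (offdiag_block_inv t k *m offdiag_block t x y z) = 4 * vec3 x y z k 0.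
Proof.
move=> t0; rewrite /mxtrace !big_ord_recl big_ord0 !mxE !big_ord_recl !big_ord0 !mxE.
by case: k => [[|[|[|//]]] Hk] /=; field.
Qed.

(* Multiplying [J_k A + A^T J_k = J (B^T Z_k)] by the inverse of [J_k = J (Z_k)] and
   taking traces gives [2 tr A] on the left; on the right, [J_k^-1 J_l] has trace [8]
   if [l = k] and [0] otherwise. *)
Lemma lambda_deriv_trace (R : realType) (t : R) (A : 'M[R]_8) (B : 'M[R]_3) :
    1 < t ->
    (forall u v, B *m lambda t u v = lambda t (A *m u) v + lambda t u (A *m v)) ->
  4 * \tr B = 3 * \tr A.
Proof.
move=> t1 AB; have t0 : t != 0 by rewrite gt_eqF // (lt_trans ltr01).
suff diagB k : \tr A = 4 * B k k.
  rewrite [\tr B]/mxtrace !big_ord_recl big_ord0 /= addr0 !mulrDr -!diagB; ring.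
pose Z := B^T *m evec k; pose Q := @order_mx R.
have ZE : Z = vec3 (Z 0 0) (Z 1 0) (Z 2 0) by exact: vec3E.
have ekE : evec k = vec3 (k == 0)%:R (k == 1)%:R (k == 2)%:R :> 'cV[R]_3.
  apply/matrixP => i j; rewrite !mxE ord1 eqxx andbT.
  by case: k {Z ZE} => [[|[|[|//]]] Hk]; case: i => [[|[|[|//]]] Hi].
have QQ : Q *m Q^T = 1%:M.
  by apply: (mulmx1C (A := Q^T : 'M_8) (B := Q : 'M_8)); exact: order_mx_orth.
have := Jop_deriv (evec k) AB; rewrite -/Z ZE ekE !Jop_lambda.
move=> /(congr1 (fun J => Q^T *m J *m Q)).
rewrite mulmxDr mulmxDl Jlambda_block.
have conjA : Q^T *m (Jlambda t (k == 0)%:R (k == 1)%:R (k == 2)%:R *m A) *m Q =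
    (Q^T *m Jlambda t (k == 0)%:R (k == 1)%:R (k == 2)%:R *m Q) *m (Q^T *m A *m Q).
  by rewrite -!mulmxA (mulmxA Q Q^T) QQ mul1mx.
have conjAt : Q^T *m (A^T *m Jlambda t (k == 0)%:R (k == 1)%:R (k == 2)%:R) *m Q =
    (Q^T *m A *m Q)^T *m (Q^T *m Jlambda t (k == 0)%:R (k == 1)%:R (k == 2)%:R *m Q).
  by rewrite !trmx_mul trmxK -!mulmxA (mulmxA Q Q^T) QQ mul1mx.
rewrite conjA conjAt !Jlambda_block.
have -> : \tr A = \tr (Q^T *m A *m Q) by rewrite mxtrace_mulC mulmxA QQ mul1mx.
move: (Q^T *m A *m Q) => {conjA conjAt AB}A.
have MK := offdiag_block_invK k t0; set M' := offdiag_block_inv t k in MK.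
set Mk := offdiag_block t _ _ _ in MK *; set N := diag_block _.
set Nk := diag_block (k == 1)%:R.
(* [H] is the inverse of J_k in the reordered basis. The diagonal blocks of H J(Z) involve only [M']
   and the off-diagonal blocks of J(Z), so its trace is twice that of M' M(Z). *)
pose H := block_mx 0 M' (- M'^T) (M'^T *m Nk *m M').
have HK : H *m block_mx Nk (- Mk^T) Mk 0 = 1%:M.
  rewrite /H mulmx_block !mul0mx !mulmx0 !add0r !addr0 MK -mulmxA MK mulmx1.
  rewrite mulNmx addNr mulmxN mulNmx opprK -trmx_mul (mulmx1C MK) trmx1.
  by rewrite -scalar_mx_block.
move=> /(congr1 (fun J => \tr (H *m J))).
rewrite mulmxDr mxtraceD [X in _ = X + _](_ : _ = \tr A); last first.
  by rewrite mulmxA HK mul1mx.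
rewrite mulmxA [X in _ = _ + X]mxtrace_mulC mulmxA (mulmx1C HK) mul1mx mxtrace_tr.
rewrite /H mulmx_block !mul0mx add0r mxtrace_block mulmx0 addr0.
rewrite mulNmx mulmxN opprK -trmx_mul mxtrace_tr [in X in _ + X]mxtrace_mulC.
rewrite /M' tr_offdiag_block_inv // -ZE /Z /evec -colE !mxE; lra.
Qed.

(* The hypothesis says that the graph of [T] over the complement is isotropic. *)
Lemma lambda_no_isotropic_complement (R : realType) (t : R) (T : 'M[R]_4) : 1 < t ->
  (forall x y z, diag_block y + T^T *m offdiag_block t x y z
     - (offdiag_block t x y z)^T *m T = 0) -> False.
Proof.
move=> t1 H.
pose o0 := @Ordinal 4 0 isT; pose o1 := @Ordinal 4 1 isT.
pose o2 := @Ordinal 4 2 isT; pose o3 := @Ordinal 4 3 isT.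
have ent x y z i j := congr1 (fun A : 'M[R]_4 => A i j) (H x y z).
have e03 := ent 0 1 0 o0 o3.
have e12 := ent 0 1 0 o1 o2.
have s02 := ent 1 0 0 o0 o2.
have s13 := ent 1 0 0 o1 o3.
have s01 := ent 0 0 1 o0 o1.
move: e03 e12 s02 s13 s01.
rewrite !mxE !big_ord_recl !big_ord0 !mxE /=.
have -> : lift ord0 ord0 = o1 by apply: val_inj.
have -> : lift ord0 (lift ord0 ord0) = o2 by apply: val_inj.
have -> : lift ord0 (lift ord0 (lift ord0 ord0)) = o3 by apply: val_inj.
have -> : ord0 = o0 by apply: val_inj.
move=> e03 e12 s02 s13 s01.
(* The [x] and [z] entries identify T02, T20, T13 and T31, and [e12] makes their common value 1/2.
   Then [e03], that is 1 + T20 + t T13 = 0, reads 3 + t = 0. *)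
have T13 : T o1 o3 = 2^-1 by lra.
have T20 : T o2 o0 = 2^-1 by lra.
by move: e03; rewrite T13 T20; lra.
Qed.

Lemma lambda_no_nilsoliton (R : realType) (t : R)
    (g : {dot 'cV[R]_(8 + 3) for idfun}) :
  1 < t -> ~ nilsoliton (lambda t) g.
Proof.
move=> t1 [c [D [dD ricE]]]; pose Q := @order_mx R.
have D12 : ursubmx D = 0.
  apply: (mul_bracket_eq0 _ (lambda_nonsingular t1)) => // u v.
  by case: (derivation_blocks dD u v).
have trD := lambda_deriv_trace t1 (fun u v => (derivation_blocks dD u v).2).
(* [S] is the metric on the orthogonal complement of n_2, identified with n_1. *)
have [S Sp extS] := posdef_block_orth (posdef_gram g).
have Sp' : posdef (Q^T *m S *m Q).
  apply: posdef_conj => // v v0; rewrite -[v]mul1mx -(order_mx_orth R).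
  by rewrite -mulmxA v0 mulmx0.
(* A second splitting, inside n_1: the last four columns of [L] are an orthonormal basis of W, the
   first four one of its orthogonal U. *)
have [S' S'p extS'] := @posdef_block_orth R 4 4 _ Sp'.
have [X XE] := posdef_orth S'p.
have [V VE] := posdef_orth (@posdef_drsubmx R 4 4 _ Sp').
have [Y /= LE] := extS' X V XE VE.
have [P2 P2E] := posdef_orth (posdef_drsubmx (posdef_gram g)).
set L := block_mx X 0 Y V in LE.
pose P1 : 'M[R]_8 := Q *m L.
have P1E : P1^T *m S *m P1 = 1%:M by rewrite -LE /P1 trmx_mul !mulmxA.
have [P21 PE] := extS P1 P2 P1E P2E.
have [_ uX] := mulmx1_unit XE; have [_ uP2] := mulmx1_unit P2E.
have muE a b x y z : dotp (lambda t (P1 *m evec a) (P1 *m evec b)) (vec3 x y z) =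
    (L^T *m block_mx (diag_block y) (- (offdiag_block t x y z)^T)
           (offdiag_block t x y z) 0 *m L) b a.
  rewrite -Jop_spec Jop_lambda -Jlambda_block -dotp_mul_evec /P1.
  by rewrite -!mulmxA [RHS]dotp_mull trmxK [RHS]dotp_mull trmxK.
have tensor0 a b : (forall k, bracket_tensor (lambda t) P1 P2 a k b = 0) <->
    lambda t (P1 *m evec a) (P1 *m evec b) = 0.
  split=> [M0|mu0 k]; last by rewrite mxE mu0 mulmx0 mxE.
  rewrite -[LHS](mulKVmx uP2); set w := invmx P2 *m _.
  have -> : w = 0 by apply/matrixP => k l; rewrite ord1 [RHS]mxE -(M0 k) [RHS]mxE.
  by rewrite mulmx0.
have LKL x y z : L^T *m block_mx (diag_block y) (- (offdiag_block t x y z)^T)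
      (offdiag_block t x y z) 0 *m L =
    block_mx (X^T *m diag_block y *m X + Y^T *m offdiag_block t x y z *m X
      - X^T *m (offdiag_block t x y z)^T *m Y)
      (- (X^T *m (offdiag_block t x y z)^T *m V))
      (V^T *m offdiag_block t x y z *m X) 0.
  rewrite /L tr_block_mx trmx0 !mulmx_block !mul0mx !mulmx0 !add0r !addr0.
  by rewrite !mulmxDl !mulmxN !mulNmx !mul0mx addr0.
have W0 (a b : 'I_4) k :
    bracket_tensor (lambda t) P1 P2 (rshift 4 a) k (rshift 4 b) = 0.
  apply: (tensor0 (rshift 4 a) (rshift 4 b)).2 k; apply/matrixP => i j.
  rewrite ord1 [RHS]mxE -dotp_evec.
  by rewrite (vec3E (evec i)) muE LKL block_mxEdr mxE.
(* Here beta is tr A / 4; the second trace is then [lambda_deriv_trace]. *)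
have trA : \tr (ulsubmx D) = \tr (ulsubmx D) / 4 / 2 * 8%:R by field.
have trB : \tr (drsubmx D) = \tr (ulsubmx D) / 4 * 3%:R by move: trD; lra.
have [kappa sumM] := nilsoliton_bracket_tensor PE dD ricE D12 trA trB.
have U0 := @isotropic_complement _ 4 _ _ _ (@bracket_tensor_skew _ _ _ _ _ _) sumM W0.
(* U is spanned by the columns of (X; Y), hence it is the graph of [T]. *)
pose T := Y *m invmx X.
apply: (@lambda_no_isotropic_complement R t T t1) => x y z.
have ul0 : X^T *m diag_block y *m X + Y^T *m offdiag_block t x y z *m X
      - X^T *m (offdiag_block t x y z)^T *m Y = 0.
  apply/matrixP => b a; rewrite [RHS]mxE.
  have mu0 := (tensor0 (lshift 4 a) (lshift 4 b)).1 (U0 a b).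
  have := muE (lshift 4 a) (lshift 4 b) x y z.
  by rewrite mu0 LKL block_mxEul => <-; rewrite /dotp linear0 mul0mx mxE.
have := congr1 (fun A => (invmx X)^T *m A *m invmx X) ul0.
have XX : (invmx X)^T *m X^T = 1%:M by rewrite -trmx_mul mulmxV // trmx1.
rewrite mulmx0 mul0mx mulmxBr mulmxDr mulmxBl mulmxDl !mulmxA XX !mul1mx.
rewrite -[X in X + _ - _]mulmxA -[X in _ + X - _]mulmxA (mulmxV uX) !mulmx1.
by rewrite -trmx_mul.
Qed.

Theorem proposition4p5 (R : realType) :
  [/\ (* nonsingular *)
      forall t : R, 1 < t -> nonsingular (lambda t),
      (* pairwise non-isomorphic *)
      forall s t : R, 1 < s -> 1 < t -> s != t ->
        ~ lie_isomorphic (lambda s) (lambda t),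
      (* Pfaffian forms, with a sign depending only on J0 *)
      forall (J0 : 'M[R]_8) (Pf : 'M[R]_8 -> R), is_pfaffian J0 Pf ->
        exists2 e : R, e = 1 \/ e = -1 &
          forall t x y z : R, 1 < t ->
            e * pfaffian_form Pf (lambda t) x y z =
            (x ^+ 2 + y ^+ 2 + z ^+ 2) * (x ^+ 2 + t * y ^+ 2 + z ^+ 2)
    & (* no nilsoliton inner product *)
      forall t : R, 1 < t ->
        forall g : {dot 'cV[R]_(8 + 3) for idfun}, ~ nilsoliton (lambda t) g].
Proof.
split.
- exact: lambda_nonsingular.
- by move=> s t s1 t1 /eqP + iso; apply; exact: lambda_isomorphic_eq iso.
- move=> J0 Pf /pfaffian_lambda[e e1 eE]; exists e => // t x y z _; exact: eE.
- by move=> t t1 g; exact: lambda_no_nilsoliton.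
Qed.
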